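(* Let $u\in H^1(S^1)$ with $u>0$. Then $$\int_0^{2\pi}\Big(u_\theta^2-\tfrac14u^2\Big)\,d\theta\ \int_0^{2\pi}u^{-2}(\theta)\,d\theta\ \ge\ -\pi^2,$$ and equality holds if and only if $$u(\theta)=c\sqrt{\lambda^2\cos^2\frac{\theta-\alpha}{2}+\lambda^{-2}\sin^2\frac{\theta-\alpha}{2}}$$ for some $\lambda,c>0$ and $\alpha\in[0,2\pi)$.
   Context: $S^1$ is the unit circle, parametrized by the angle $\theta\in[0,2\pi]$; functions on $S^1$ are identified with $2\pi$-periodic functions of $\theta$, and $u_\theta$ denotes the derivative in $\theta$. $H^1(S^1)$ is the usual Sobolev space (its elements are identified with their continuous representatives); $u>0$ means $u$ is positive everywhere. *)

(* Defs.v *)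
(* Functions on the unit circle are represented by 2pi-periodic functions R -> R. *)
From HB Require Import structures.
From mathcomp Require Import all_boot all_order all_algebra.
From mathcomp Require Import all_classical all_reals all_analysis.
Set Implicit Arguments.
Unset Strict Implicit.
Unset Printing Implicit Defensive.
Import Order.TTheory GRing.Theory Num.Theory.
Import numFieldNormedType.Exports.
Local Open Scope classical_set_scope.
Local Open Scope ring_scope.

Definition circle_fun (R : realType) (f : R -> R) : Prop :=
  periodic f (2 * pi).

Definition circle_integral (R : realType) (f : R -> R) : R :=
  \int[lebesgue_measure]_(x in `[0, 2 * pi]) f x.

Definition L2_circle (R : realType) (f : R -> R) : Prop :=
  [/\ circle_fun f,
      measurable_fun (`[0, 2 * pi] : set R) f &
      lebesgue_measure.-integrable (`[0, 2 * pi] : set R)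
        (EFin \o (fun x => f x ^+ 2))].

Definition smooth_circle (R : realType) (phi : R -> R) : Prop :=
  circle_fun phi /\ forall (n : nat) (x : R), derivable (derive1n n phi) x 1.

(* No boundary term: the test functions are smooth on the whole (closed) circle. *)
Definition weak_derivative (R : realType) (u v : R -> R) : Prop :=
  forall phi : R -> R, smooth_circle phi ->
    circle_integral (fun x => u x * derive1 phi x) =
    - circle_integral (fun x => v x * phi x).

Definition H1_circle (R : realType) (u : R -> R) : Prop :=
  L2_circle u /\ exists v : R -> R, L2_circle v /\ weak_derivative u v.

(* Main.v *)
Require Import Defs.
From HB Require Import structures.
From mathcomp Require Import all_boot all_order all_algebra.
From mathcomp Require Import all_classical all_reals all_analysis.
From mathcomp Require Import measurable_realfun ring lra.
Import Order.TTheory GRing.Theory Num.Theory.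
Import numFieldNormedType.Exports.
Local Open Scope classical_set_scope.
Local Open Scope ring_scope.

(* For smooth u the curve z = u (cos T, sin T) with T' = k u^-2, where k is pi over
   the integral of u^-2, is antiperiodic, so Wirtinger's inequality with constant
   1/4 applies to its components and gives the bound.  A general u is reached by
   convolution with the trigonometric polynomials ((1 + cos s)/2)^n, which does not
   increase the L2 norm of the derivative.  At equality the vanishing of the first
   variation makes u a C^2 solution of u'' = k^2 u^-3 - u/4, for which u^2 satisfies
   (u^2)'' + u^2 = const.  Conversely, for the explicit u both integrals have
   elementary antiderivatives, once du is known to agree almost everywhere with
   the classical derivative. *)

(** * Derivation rules *)

(** The constant 1/4 is the first Dirichlet eigenvalue of an interval of length 2 pi: an
    antiperiodic function vanishing at b also vanishes at b + 2 pi. With L the integral of u^-2 and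
    k L = pi, Wirtinger's inequality says that the first integral plus k^2 L is nonnegative, and
    multiplying by L gives the bound. The obstacle is that the derivative of u exists only weakly,
    so each classical argument runs either on mollified functions or after regularity has been
    gained. The mollifying kernels are finite sums of products p(x) q(t): exchanging integrals and
    differentiating under the integral sign then reduce to linearity. The first variation never
    differentiates the integral of u^-2. The inequality, already known for every positive u + e phi,
    is compared with its equality at e = 0. *)

Section derivation_rules.
Set Implicit Arguments.
Unset Strict Implicit.
Context {R : realType}.
Implicit Types (f g : R -> R) (x a b : R).

Lemma is_derive_funD f g x a b : is_derive x 1 f a -> is_derive x 1 g b ->
  is_derive x 1 (fun y => f y + g y) (a + b).
Proof. by move=> ? ?; exact: is_deriveD. Qed.

Lemma is_derive_funN f x a : is_derive x 1 f a ->
  is_derive x 1 (fun y => - f y) (- a).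
Proof. by move=> ?; exact: is_deriveN. Qed.

Lemma is_derive_funM f g x a b : is_derive x 1 f a -> is_derive x 1 g b ->
  is_derive x 1 (fun y => f y * g y) (f x * b + g x * a).
Proof. by move=> ? ?; exact: is_deriveM. Qed.

Lemma is_derive_funX f n x a : is_derive x 1 f a ->
  is_derive x 1 (fun y => f y ^+ n) (n%:R * f x ^+ n.-1 * a).
Proof.
move=> fa; elim: n => [|n IH].
  rewrite mul0r mul0r; exact: is_derive_cst.
have -> : (fun y => f y ^+ n.+1) = (fun y => f y * f y ^+ n).
  by apply/funext => y; rewrite exprS.
apply: (is_derive_eq (is_derive_funM fa IH)).
case: n {IH} => [|n] /=; first ring.
by rewrite exprS -!natr1; ring.
Qed.

Lemma is_derive_funV f x a : f x != 0 -> is_derive x 1 f a ->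
  is_derive x 1 (fun y => (f y)^-1) (- (f x)^-1 ^+ 2 * a).
Proof.
move=> fx0 fa; split; first exact: derivableV.
by rewrite deriveV// derive_val exprVn.
Qed.

Lemma is_derive_funC f g x a b : is_derive x 1 g b -> is_derive (g x) 1 f a ->
  is_derive x 1 (fun y => f (g y)) (a * b).
Proof. by move=> gb fa; exact: (@is_derive1_comp _ f g). Qed.

Lemma is_derive_continuous f (df : R -> R) :
  (forall x, is_derive x 1 f (df x)) -> continuous f.
Proof.
by move=> dff x; apply/differentiable_continuous/derivable1_diffP; case: (dff x).
Qed.

Lemma is_derive_fun_cst x (k : R) : is_derive x 1 (fun=> k) 0.
Proof. exact: is_derive_cst. Qed.

Lemma is_derive_fun_id x : is_derive x 1 (fun y => y) 1.
Proof. exact: is_derive_id. Qed.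

End derivation_rules.

Ltac derive_step := lazymatch goal with
  | |- is_derive _ _ (fun y => y) _ => exact: is_derive_fun_id
  | |- is_derive _ _ (fun y => @?f y + @?g y) _ => eapply (@is_derive_funD _ f g)
  | |- is_derive _ _ (fun y => - @?f y) _ => eapply (@is_derive_funN _ f)
  | |- is_derive _ _ (fun y => @?f y * @?g y) _ => eapply (@is_derive_funM _ f g)
  | |- is_derive _ _ (fun y => @?f y ^+ ?n) _ => eapply (@is_derive_funX _ f n)
  | |- is_derive _ _ (fun y => (@?f y)^-1) _ =>
      first [exact: is_derive_fun_cst | eapply (@is_derive_funV _ f)]
  | |- is_derive _ _ (fun y => cos (@?g y)) _ =>
      eapply (@is_derive_funC _ _ g); [|exact: is_derive_cos]
  | |- is_derive _ _ (fun y => sin (@?g y)) _ =>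
      eapply (@is_derive_funC _ _ g); [|exact: is_derive_sin]
  | |- is_derive _ _ (fun y => tan (@?g y)) _ =>
      eapply (@is_derive_funC _ _ g); [|apply: is_derive_tan]
  | |- is_derive _ _ (fun y => atan (@?g y)) _ =>
      eapply (@is_derive_funC _ _ g); [|exact: is_derive1_atan]
  | |- is_derive _ _ (fun y => Num.sqrt (@?g y)) _ =>
      eapply (@is_derive_funC _ _ g); [|apply: is_derive1_sqrt]
  | |- is_derive _ _ (fun y => _) _ => first [assumption | exact: is_derive_fun_cst | solve [eauto]]
  | |- _ => idtac
  end.

(** The rules fill in the derivative as an existential variable. What remains are side conditions,
    such as nonvanishing denominators, and then the identity between the computed and the announced
    derivative. *)
Ltac derive := eapply is_derive_eq; [repeat derive_step | ].

(** * Integration over the circle *)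

Section circle_integral.
Set Implicit Arguments.
Unset Strict Implicit.
Context {R : realType}.
Implicit Types (f g : R -> R) (x k : R).
Local Notation mu := (@lebesgue_measure R).
Local Notation circle := (`[0%R, (2 * pi)%R]%classic : set R).

Definition circle_integrable f := mu.-integrable circle (EFin \o f).

Lemma twopi_gt0 : 0 < 2 * pi :> R.
Proof. by rewrite mulr_gt0// pi_gt0. Qed.

Lemma circle_integrable_continuous f : continuous f -> circle_integrable f.
Proof.
move=> cf; apply: continuous_compact_integrable; first exact: segment_compact.
exact: continuous_subspaceT.
Qed.

Lemma circle_integrableD f g : circle_integrable f -> circle_integrable g ->
  circle_integrable (fun x => f x + g x).
Proof. by move=> fi gi; exact: (@integrableD _ _ _ mu circle _ _ _ fi gi). Qed.

Lemma circle_integrableZ k f : circle_integrable f ->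
  circle_integrable (fun x => k * f x).
Proof. by move=> fi; exact: (@integrableZl _ _ _ mu circle _ k _ fi). Qed.

Lemma circle_integrableN f : circle_integrable f ->
  circle_integrable (fun x => - f x).
Proof. by move=> fi; have := circle_integrableZ (-1) fi; under eq_fun do rewrite mulN1r. Qed.

Lemma circle_integrableB f g : circle_integrable f -> circle_integrable g ->
  circle_integrable (fun x => f x - g x).
Proof. by move=> fi /circle_integrableN; exact: circle_integrableD. Qed.

Lemma circle_integrable_measurable f : circle_integrable f ->
  measurable_fun circle f.
Proof. by move=> fi; apply/measurable_EFinP; exact: (measurable_int mu fi). Qed.

Lemma le_circle_integrable f g : measurable_fun circle f ->
  (forall x, `|f x| <= g x) -> circle_integrable g -> circle_integrable f.
Proof.
move=> mf fg gi; apply: (@le_integrable _ _ _ mu circle _ _ _ _ _ gi) => //.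
  exact/measurable_EFinP.
by move=> x _ /=; rewrite lee_fin (le_trans (fg x))// ler_norm.
Qed.

Lemma continuous_bounded_circle f : continuous f ->
  exists2 M, 0 <= M & forall x, x \in `[0, 2 * pi] -> `|f x| <= M.
Proof.
move=> cf; have cn : continuous (fun x => `|f x|).
  by move=> x; apply: (continuous_comp (cf x)); exact: norm_continuous.
have [c _ cmax] := EVT_max (ltW twopi_gt0) (continuous_subspaceT cn).
by exists `|f c|.
Qed.

Lemma circle_integrableM f g : circle_integrable f -> continuous g ->
  circle_integrable (fun x => f x * g x).
Proof.
move=> fi cg; have [M M0 gM] := continuous_bounded_circle cg.
have MI : circle_integrable (fun x => M * `|f x|).
  by apply: circle_integrableZ; exact: integrable_norm fi.
apply: (@le_integrable _ _ _ mu circle _ _ _ _ _ MI) => //.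
  apply/measurable_EFinP; apply: measurable_funM.
    exact: circle_integrable_measurable.
  exact: circle_integrable_measurable (circle_integrable_continuous cg).
move=> x xC /=; rewrite lee_fin normrM (ger0_norm (mulr_ge0 _ _))//.
by rewrite mulrC ler_wpM2r// gM.
Qed.

Lemma circle_integralD f g : circle_integrable f -> circle_integrable g ->
  circle_integral (fun x => f x + g x) = circle_integral f + circle_integral g.
Proof. by move=> fi gi; exact: RintegralD. Qed.

Lemma circle_integralB f g : circle_integrable f -> circle_integrable g ->
  circle_integral (fun x => f x - g x) = circle_integral f - circle_integral g.
Proof. by move=> fi gi; exact: RintegralB. Qed.

Lemma circle_integralZ k f : circle_integrable f ->
  circle_integral (fun x => k * f x) = k * circle_integral f.
Proof. by move=> fi; exact: RintegralZl. Qed.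

Lemma circle_integral_cst k : circle_integral (fun=> k) = 2 * pi * k.
Proof.
rewrite /circle_integral Rintegral_cst// mulrC; congr (_ * _).
transitivity (fine (mu circle)) => //.
by rewrite lebesgue_measure_itv/= lte_fin twopi_gt0 -EFinB/= subr0.
Qed.

Lemma circle_integral_ge0 f : (forall x, 0 <= f x) -> 0 <= circle_integral f.
Proof. by move=> f0; apply: Rintegral_ge0 => x _; exact: f0. Qed.

Lemma le_circle_integral f g : circle_integrable f -> circle_integrable g ->
  (forall x, x \in `[0, 2 * pi] -> f x <= g x) ->
  circle_integral f <= circle_integral g.
Proof. by move=> fi gi fg; exact: le_Rintegral. Qed.

Lemma circle_integral_dist f g (e : R) :
  circle_integrable f -> circle_integrable g ->
  (forall x, x \in `[0, 2 * pi] -> `|f x - g x| <= e) ->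
  `|circle_integral f - circle_integral g| <= 2 * pi * e.
Proof.
move=> fi gi fg; rewrite -circle_integralB//.
have fgi := circle_integrableB fi gi.
apply: (le_trans (@le_normr_Rintegral _ _ _ mu circle _ _ fgi)) => //.
rewrite -circle_integral_cst; apply: le_circle_integral => //.
  exact: integrable_norm fgi.
by apply: circle_integrable_continuous => x; exact: cst_continuous.
Qed.

Lemma circle_integral_FTC (F f : R -> R) : continuous f ->
  (forall x, is_derive x 1 F (f x)) -> circle_integral f = F (2 * pi) - F 0.
Proof.
move=> cf dF; have cF := is_derive_continuous dF.
rewrite /circle_integral /Rintegral (@continuous_FTC2 R f F)//; first exact: twopi_gt0.
- exact: continuous_subspaceT.
- split; first by move=> x _; case: (dF x).
  + by apply: cvg_at_right_filter; exact: cF.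
  + by apply: cvg_at_left_filter; exact: cF.
- by move=> x _; rewrite derive1E; case: (dF x).
Qed.

(** The circle has finite length and |f| <= 1 + f^2. *)
Lemma L2_circle_integrable f : L2_circle f -> circle_integrable f.
Proof.
case=> _ mf f2i; apply: (@le_circle_integrable f (fun x => 1 + f x ^+ 2)) => //.
  move=> x; rewrite ler_norml; nra.
apply: circle_integrableD => //.
by apply: circle_integrable_continuous => x; exact: cst_continuous.
Qed.

End circle_integral.

(** * Primitives on the line and moduli of continuity *)

Section calculus.
Set Implicit Arguments.
Unset Strict Implicit.
Context {R : realType}.
Implicit Types (f g : R -> R) (x k : R).
Local Notation mu := (@lebesgue_measure R).

(** The primitive is the signed integral from 0. Near a given x it differs by a constant from the
    integral over [[a, y]], with [a] to the left of both x and 0, and there the fundamental theorem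
    of calculus applies. *)
Lemma continuous_primitive f : continuous f ->
  exists F : R -> R, forall x, is_derive x 1 F (f x).
Proof.
move=> cf.
have fi a b : mu.-integrable (`[a, b]%classic : set R) (EFin \o f).
  apply: continuous_compact_integrable; first exact: segment_compact.
  exact: continuous_subspaceT.
pose P y := (\int[mu]_(t in `]0%R, y]%classic) f t
             - \int[mu]_(t in `]y, 0%R]%classic) f t).
have PE (a y : R) : a <= 0 -> a <= y ->
    P y = \int[mu]_(t in `[a, y]%classic) f t - \int[mu]_(t in `[a, 0%R]%classic) f t.
  move=> a0 ay; rewrite /P; case: (leP 0 y) => y0.
    rewrite (@set_itv_ge _ _ (BRight y)) ?Rintegral_set0 ?bnd_simp -?leNgt// subr0.
    by rewrite -(@Rintegral_itvB _ f (BLeft a) (BRight y) 0) ?bnd_simp.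
  rewrite (@set_itv_ge _ _ (BRight 0)) ?Rintegral_set0 ?bnd_simp -?leNgt ?(ltW y0)//.
  rewrite -(@Rintegral_itvB _ f (BLeft a) (BRight 0) y) ?bnd_simp// ?(ltW y0)//.
  by rewrite sub0r opprB.
exists P => x; pose a := Num.min x 0 - 1.
have ax : a < x.
  have : Num.min x 0 <= x by rewrite ge_min lexx.
  by rewrite /a; lra.
have a0 : a <= 0.
  have : Num.min x 0 <= 0 by rewrite ge_min lexx orbT.
  by rewrite /a; lra.
have xx1 : x < x + 1 by rewrite ltrDl.
have [dG G'] := @continuous_FTC1_closed R f a x (x + 1) xx1 (fi _ _) ax (cf x).
pose G y := \int[mu]_(t in `[a, y]%classic) f t.
apply: (@near_eq_is_derive _ _ _ (fun y => G y + - G 0)).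
  near=> y; rewrite (PE a)//; apply/ltW; near: y; exact: lt_nbhsr.
have {}G' : is_derive x 1 G (f x).
  by apply: DeriveDef; [exact: dG|rewrite -derive1E; exact: G'].
rewrite -[f x]addr0; apply: is_derive_funD => //; exact: is_derive_fun_cst.
Unshelve. all: by end_near. Qed.

Lemma is_derive_eq0_cst f : (forall x, is_derive x 1 f 0) -> forall x y, f x = f y.
Proof. by move=> f0 x y; exact: is_derive_0_is_cst. Qed.

Lemma is_derive_ge0_nondecreasing f (df : R -> R) (a b : R) : a <= b ->
  (forall x, x \in `[a, b] -> is_derive x 1 f (df x)) ->
  (forall x, x \in `[a, b] -> 0 <= df x) -> f a <= f b.
Proof.
move=> ab dff df0; rewrite -subr_ge0.
have dff' x : x \in `]a, b[ -> is_derive x 1 f (df x).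
  by move=> xab; apply: dff; exact: subset_itv_oo_cc.
have cf : {within `[a, b], continuous f}.
  by apply: derivable_within_continuous => x xab; case: (dff x xab).
have [c cab fE] := @MVT_segment R f df a b ab dff' cf.
by rewrite fE mulr_ge0 ?subr_ge0// df0.
Qed.

Lemma uniformly_continuous_segment f (a b e : R) : continuous f -> 0 < e ->
  exists2 d, 0 < d & forall x t, x \in `[a, b] -> `|x - t| < d -> `|f x - f t| < e.
Proof.
move=> cf e0.
have := @segment_compact R a b; rewrite compact_near_coveringP.
move=> /(_ R (0^'+) (fun d x => forall t, `|x - t| < d -> `|f x - f t| < e) _) cov.
have /cov : forall x, `[a, b]%classic x -> \forall x' \near x & d \near 0^'+,
    forall t, `|x' - t| < d -> `|f x' - f t| < e.
  move=> x _.
  have e2 : 0 < e / 2 by rewrite divr_gt0.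
  have /cvgrPdist_lt/(_ _ e2) := cf x.
  rewrite -filter_from_ballE => -[d /= d0 fd].
  exists (ball x (d / 2), [set r | r < d / 2]) => /=.
    split; first by apply: nbhsx_ballx; rewrite divr_gt0.
    by apply: nbhs_right_lt; rewrite divr_gt0.
  move=> [x' r] /= [xx' rd] t x't.
  have h1 : `|f x - f x'| < e / 2.
    by apply: fd; move: xx'; rewrite /ball/=; lra.
  have h2 : `|f x - f t| < e / 2.
    apply: fd; move: xx'; rewrite /ball/= => xx'.
    have := ler_normD (x - x') (x' - t); rewrite subrKA; lra.
  rewrite distrC in h1.
  have := ler_normD (f x' - f x) (f x - f t); rewrite subrKA; lra.
move=> near_d.
have [d dd] := @filter_ex _ _ (at_right_proper_filter (0 : R)) _ (filterI near_d (nbhs_right_gt 0)).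
case: dd => dP d0.
by exists d => // x t xab; exact: dP.
Qed.

Lemma cosD2piE x : cos (x + 2 * pi) = cos x.
Proof. by rewrite mulr_natl cosD2pi. Qed.

(* Korovkin's form of uniform continuity: positive unit-mass kernels are tested
   only against the single function 1 - cos. *)
Lemma circle_modulus f (e : R) : continuous f -> circle_fun f -> 0 < e ->
  exists2 C, 0 <= C & forall x t, x \in `[0, 2 * pi] -> t \in `[0, 2 * pi] ->
    `|f x - f t| <= e + C * (1 - cos (x - t)).
Proof.
move=> cf pf e0; have [M M0 fM] := continuous_bounded_circle cf.
have pi0 : 0 < pi :> R := pi_gt0 R.
(* Two periods, since one of the points may be shifted by 2 pi below. *)
have [d d0 fd] := uniformly_continuous_segment 0 (4 * pi) cf e0.
pose d' := Num.min d pi.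
have d'0 : 0 < d' by rewrite lt_min d0.
have d'd : d' <= d by rewrite ge_min lexx.
have d'pi : d' <= pi by rewrite ge_min lexx orbT.
have cosd : cos d' < 1.
  by rewrite -cos0 ltr_cos// in_itv/= ?lexx ?(ltW pi0)// (ltW d'0).
have c0 : 0 < 1 - cos d' by rewrite subr_gt0.
(* Cosine decreases on [0, pi], so at distances between d' and pi the term C (1 - cos) is at least 2
   M, which dominates |f x - f t|. *)
pose C := 2 * M / (1 - cos d').
have C0 : 0 <= C by rewrite /C divr_ge0 ?mulr_ge0// ltW.
have key x y : x \in `[0, 4 * pi] -> `|x - y| <= pi -> `|f x| <= M -> `|f y| <= M ->
    `|f x - f y| <= e + C * (1 - cos (x - y)).
  move=> x4 xy fx fy; have [xyd|dxy] := ltP `|x - y| d'.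
    rewrite (le_trans (ltW (fd _ _ x4 (lt_le_trans xyd d'd))))// lerDl.
    by rewrite mulr_ge0// subr_ge0 cos_le1.
  have cxy : cos (x - y) <= cos d'.
    by rewrite -cos_norm leNgt ltr_cos -?leNgt// in_itv/= ?normr_ge0 ?(ltW d'0).
  have -> : C * (1 - cos (x - y)) = 2 * M * ((1 - cos (x - y)) / (1 - cos d')).
    by rewrite /C; field; rewrite gt_eqF.
  have : 1 <= (1 - cos (x - y)) / (1 - cos d').
    by rewrite ler_pdivlMr// mul1r lerD2l lerN2.
  have := ler_normB (f x) (f y); nra.
exists C => // x t xC tC; have [fx ft] := (fM _ xC, fM _ tC).
move: (xC) (tC); rewrite !in_itv/= => /andP[x0 x2] /andP[t0 t2].
(* Points of [0, 2 pi] more than pi apart are closer along the circle the other way round; shifting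
   the smaller one by a period reduces to [key]. *)
have [xt|xt] := leP `|x - t| pi.
  by apply: key => //; rewrite in_itv/= x0/=; lra.
move: xt; rewrite ltr_normr => /orP[xt|xt].
  have <- : cos (x - (t + 2 * pi)) = cos (x - t) by rewrite -cosD2piE opprD addrA subrK.
  have h : `|x - (t + 2 * pi)| <= pi by rewrite ler_norml; lra.
  have h4 : x \in `[0, 4 * pi] by rewrite in_itv/= x0/=; lra.
  by rewrite -(pf t); apply: key => //; rewrite pf.
have <- : cos (x + 2 * pi - t) = cos (x - t) by rewrite -[RHS]cosD2piE addrAC.
have h : `|x + 2 * pi - t| <= pi by rewrite ler_norml; lra.
have h4 : x + 2 * pi \in `[0, 4 * pi] by rewrite in_itv/=; lra.
by rewrite -(pf x); apply: key => //; rewrite pf.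
Qed.

End calculus.

(** * Trigonometric polynomials and separable kernels *)

Section trigonometric_polynomials.
Set Implicit Arguments.
Unset Strict Implicit.
Context {R : realType}.
Implicit Types (f g p q : R -> R) (x y t : R).
Local Opaque circle_integral.

(** Trigonometric polynomials as a closure rather than as sums with coefficients: periodicity,
    smoothness and stability under derivation become short inductions. *)
Inductive trigpoly : (R -> R) -> Prop :=
| trigpoly_cst (k : R) : trigpoly (fun=> k)
| trigpoly_cos : trigpoly cos
| trigpoly_sin : trigpoly sin
| trigpolyD f g : trigpoly f -> trigpoly g -> trigpoly (fun x => f x + g x)
| trigpolyM f g : trigpoly f -> trigpoly g -> trigpoly (fun x => f x * g x).

Lemma sinD2piE x : sin (x + 2 * pi) = sin x.
Proof. by rewrite mulr_natl sinD2pi. Qed.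

Lemma trigpoly_circle_fun f : trigpoly f -> circle_fun f.
Proof.
elim=> // [x|x|g h _ IHg _ IHh x|g h _ IHg _ IHh x].
- exact: cosD2piE.
- exact: sinD2piE.
- by rewrite IHg IHh.
- by rewrite IHg IHh.
Qed.

Lemma trigpoly_derive f : trigpoly f ->
  exists2 df, trigpoly df & forall x, is_derive x 1 f (df x).
Proof.
elim=> [k|||g h tg [dg tdg gdg] th [dh tdh hdh]|g h tg [dg tdg gdg] th [dh tdh hdh]].
- by exists (fun=> 0); [exact: trigpoly_cst|move=> x; exact: is_derive_fun_cst].
- exists (fun x => -1 * sin x).
    by apply: trigpolyM; [exact: trigpoly_cst|exact: trigpoly_sin].
  by move=> x; rewrite mulN1r; exact: is_derive_cos.
- by exists cos; [exact: trigpoly_cos|move=> x; exact: is_derive_sin].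
- by exists (fun x => dg x + dh x); [exact: trigpolyD|move=> x; exact: is_derive_funD].
- exists (fun x => g x * dh x + h x * dg x).
    by apply: trigpolyD; exact: trigpolyM.
  by move=> x; exact: is_derive_funM.
Qed.

Lemma trigpoly_continuous f : trigpoly f -> continuous f.
Proof. by move=> /trigpoly_derive[df _ dff]; exact: is_derive_continuous dff. Qed.

Lemma is_derive_derive1 f (df : R -> R) :
  (forall x, is_derive x 1 f (df x)) -> derive1 f = df.
Proof. by move=> dff; apply/funext => x; rewrite derive1E; case: (dff x). Qed.

Lemma trigpoly_smooth f : trigpoly f -> smooth_circle f.
Proof.
move=> tf; split; first exact: trigpoly_circle_fun.
move=> n; elim: n f tf => [|n IH] f tf x; have [df tdf dff] := trigpoly_derive tf.
  by case: (dff x).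
by rewrite derive1Sn (is_derive_derive1 dff); exact: IH.
Qed.

(** Kernels of finite rank. Integrating f against one of them in t gives a finite combination of the
    factors p, hence a trigonometric polynomial in x for any integrable f. *)
Inductive separable : (R -> R -> R) -> Prop :=
| separable_prod p q : trigpoly p -> trigpoly q -> separable (fun x t => p x * q t)
| separableD (k l : R -> R -> R) : separable k -> separable l ->
    separable (fun x t => k x t + l x t).

Lemma separableM (k l : R -> R -> R) : separable k -> separable l ->
  separable (fun x t => k x t * l x t).
Proof.
move=> sk sl; elim: sk => [p q tp tq|k1 k2 _ IH1 _ IH2]; last first.
  under eq_fun do under eq_fun do rewrite mulrDl.
  exact: separableD.
elim: sl => [p' q' tp' tq'|l1 l2 _ IH1 _ IH2]; last first.
  under eq_fun do under eq_fun do rewrite mulrDr.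
  exact: separableD.
under eq_fun do under eq_fun do rewrite mulrACA.
by apply: (@separable_prod (fun x => p x * p' x) (fun t => q t * q' t)); exact: trigpolyM.
Qed.

Lemma separable_trigpoly (k : R -> R -> R) : separable k ->
  forall x, trigpoly (k x).
Proof.
elim=> [p q tp tq|k1 k2 _ IH1 _ IH2] x; last exact: trigpolyD.
by apply: trigpolyM => //; exact: trigpoly_cst.
Qed.

Lemma separable_trigpoly_l (k : R -> R -> R) : separable k ->
  forall t, trigpoly (k^~ t).
Proof.
elim=> [p q tp tq|k1 k2 _ IH1 _ IH2] t; last exact: trigpolyD.
by apply: trigpolyM => //; exact: trigpoly_cst.
Qed.

Lemma circle_integrable_trigpoly f p : circle_integrable f -> trigpoly p ->
  circle_integrable (fun t => f t * p t).
Proof. by move=> fi tp; exact/circle_integrableM/trigpoly_continuous. Qed.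

Lemma circle_integral_prod f p (r : R) : circle_integrable f -> trigpoly p ->
  circle_integral (fun t => f t * (r * p t)) =
  r * circle_integral (fun t => f t * p t).
Proof.
move=> fi tp; rewrite -circle_integralZ; last exact: circle_integrable_trigpoly.
by congr circle_integral; apply/funext => t; rewrite mulrCA.
Qed.

Lemma circle_integral_add f p q : circle_integrable f -> trigpoly p -> trigpoly q ->
  circle_integral (fun t => f t * (p t + q t)) =
  circle_integral (fun t => f t * p t) + circle_integral (fun t => f t * q t).
Proof.
move=> fi tp tq; rewrite -circle_integralD; [|exact: circle_integrable_trigpoly..].
by congr circle_integral; apply/funext => t; rewrite mulrDr.
Qed.

Lemma circle_integral_separableD f (k1 k2 : R -> R -> R) : circle_integrable f ->
  separable k1 -> separable k2 ->
  (fun x => circle_integral (fun t => f t * (k1 x t + k2 x t))) =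
  (fun x => circle_integral (fun t => f t * k1 x t) +
            circle_integral (fun t => f t * k2 x t)).
Proof.
move=> fi s1 s2; apply/funext => x.
by apply: circle_integral_add => //; exact: separable_trigpoly.
Qed.

Lemma separable_integral (k : R -> R -> R) f : separable k -> circle_integrable f ->
  trigpoly (fun x => circle_integral (fun t => f t * k x t)).
Proof.
move=> sk fi; elim: sk => [p q tp tq|k1 k2 s1 IH1 s2 IH2].
  under eq_fun do rewrite circle_integral_prod//.
  by apply: trigpolyM => //; exact: trigpoly_cst.
rewrite (circle_integral_separableD fi s1 s2).
exact: trigpolyD.
Qed.

(** For a product p(x) q(t) both sides equal the integral of p times that of f q; sums follow by
    linearity. The first conjunct travels through the induction because it supplies the
    integrability that linearity requires. *)
Lemma separable_fubini (k : R -> R -> R) f : separable k -> circle_integrable f ->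
  trigpoly (fun t => circle_integral (k^~ t)) /\
  circle_integral (fun x => circle_integral (fun t => f t * k x t)) =
  circle_integral (fun t => f t * circle_integral (k^~ t)).
Proof.
move=> sk fi; elim: sk => [p q tp tq|k1 k2 s1 [t1 IH1] s2 [t2 IH2]].
  have ip : circle_integrable p by exact/circle_integrable_continuous/trigpoly_continuous.
  have E (r : R) : circle_integral (fun x => p x * r) = circle_integral p * r.
    by under eq_fun do rewrite mulrC; rewrite circle_integralZ// mulrC.
  split.
    under eq_fun do rewrite E.
    by apply: trigpolyM => //; exact: trigpoly_cst.
  under eq_fun do rewrite circle_integral_prod//.
  rewrite E; under [in RHS]eq_fun do rewrite E.
  by rewrite circle_integral_prod.
have E t : circle_integral (fun x => k1 x t + k2 x t) =
    circle_integral (k1^~ t) + circle_integral (k2^~ t).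
  by rewrite circle_integralD//;
    exact/circle_integrable_continuous/trigpoly_continuous/separable_trigpoly_l.
split.
  by under eq_fun do rewrite E; exact: trigpolyD.
rewrite (circle_integral_separableD fi s1 s2) circle_integralD; first last.
- exact/circle_integrable_continuous/trigpoly_continuous/separable_integral.
- exact/circle_integrable_continuous/trigpoly_continuous/separable_integral.
transitivity (circle_integral (fun t => f t * circle_integral (k1^~ t)) +
              circle_integral (fun t => f t * circle_integral (k2^~ t))).
  by congr (_ + _).
rewrite -(circle_integral_add fi t1 t2).
by congr circle_integral; apply/funext => t; rewrite E.
Qed.

(** The pointwise derivative is returned together with the one under the integral, so that a
    concrete kernel can identify k' afterwards. *)
Lemma separable_derive (k : R -> R -> R) : separable k ->
  exists k', [/\ separable k', (forall x t, is_derive x 1 (k^~ t) (k' x t)) &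
    forall f, circle_integrable f -> forall x,
    is_derive x 1 (fun x => circle_integral (fun t => f t * k x t))
                  (circle_integral (fun t => f t * k' x t))].
Proof.
elim=> [p q tp tq|k1 k2 s1 [k1' [s1' d1 i1]] s2 [k2' [s2' d2 i2]]].
  have [dp tdp pdp] := trigpoly_derive tp.
  have E (r x : R) : is_derive x 1 (fun x => p x * r) (dp x * r).
    apply: is_derive_eq (is_derive_funM (pdp x) (is_derive_fun_cst x r)) _.
    by rewrite mulr0 add0r mulrC.
  exists (fun x t => dp x * q t); split; first exact: separable_prod.
    by move=> x t; exact: E.
  move=> f fi x; rewrite circle_integral_prod//.
  by under eq_fun do rewrite circle_integral_prod//; exact: E.
exists (fun x t => k1' x t + k2' x t); split; first exact: separableD.
  by move=> x t; exact: is_derive_funD.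
move=> f fi x; rewrite (circle_integral_separableD fi s1 s2).
apply: (is_derive_eq (is_derive_funD (i1 f fi x) (i2 f fi x))).
by rewrite (circle_integral_add fi (separable_trigpoly s1' x) (separable_trigpoly s2' x)).
Qed.

End trigonometric_polynomials.

(** * Mollification *)

Section mollification.
Set Implicit Arguments.
Unset Strict Implicit.
Context {R : realType}.
Implicit Types (f g p q : R -> R) (x y t s : R) (n : nat).
Local Opaque circle_integral.

(** This is cos(s/2)^(2n), the de la Vallee Poussin kernel before normalization: even, nonnegative
    and concentrating at 0 modulo 2 pi. *)
Definition cos_kernel n s : R := ((1 + cos s) / 2) ^+ n.

Definition kernel_mass n := circle_integral (cos_kernel n).

Definition mollify n f x :=
  circle_integral (fun t => f t * (cos_kernel n (x - t) / kernel_mass n)).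

Lemma cos_kernel_ge0 n s : 0 <= cos_kernel n s.
Proof. by rewrite exprn_ge0// divr_ge0//; have := cos_geN1 s; lra. Qed.

Lemma cos_kernelS n s : cos_kernel n.+1 s = (1 + cos s) / 2 * cos_kernel n s.
Proof. exact: exprS. Qed.

Lemma cos_kernelB n x t : cos_kernel n (x - t) = cos_kernel n (t - x).
Proof. by rewrite /cos_kernel -cosN opprB. Qed.

(** The addition formula for cos(x - t) makes each factor separable. The scalar c lets the
    normalized kernel be an instance. *)
Lemma separable_cos_kernel n (c : R) :
  separable (fun x t => cos_kernel n (x - t) * c).
Proof.
elim: n c => [|n IH] c.
  apply: (@separable_prod R (fun=> 1) (fun=> c)); exact: trigpoly_cst.
have -> : (fun x t => cos_kernel n.+1 (x - t) * c) =
  (fun x t => (cos_kernel n (x - t) * c) *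
     ((2^-1 * 1 + (cos x * 2^-1) * cos t) + (sin x * 2^-1) * sin t)).
  apply/funext => x; apply/funext => t; rewrite cos_kernelS cosB; lra.
have sp p q : trigpoly p -> trigpoly q -> separable (fun x t => p x * q t).
  exact: separable_prod.
have [tc ts] := (@trigpoly_cos R, @trigpoly_sin R).
have hp (p : R -> R) : trigpoly p -> trigpoly (fun x => p x * 2^-1).
  by move=> tp; apply: trigpolyM => //; exact: trigpoly_cst.
apply: separableM => //; apply: separableD; first apply: separableD.
- by apply: (sp (fun=> 2^-1) (fun=> 1)); exact: trigpoly_cst.
- by apply: (sp (fun x => cos x * 2^-1) cos) => //; exact: hp.
- by apply: (sp (fun x => sin x * 2^-1) sin) => //; exact: hp.
Qed.

Lemma trigpoly_cos_kernel n x (c : R) : trigpoly (fun t => cos_kernel n (x - t) * c).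
Proof. exact: (separable_trigpoly (separable_cos_kernel n c) x). Qed.

Lemma cos_kernel_trigpoly n x : trigpoly (fun t => cos_kernel n (t - x)).
Proof.
have -> : (fun t => cos_kernel n (t - x)) = (fun t => cos_kernel n (x - t) * 1).
  by apply/funext => t; rewrite cos_kernelB mulr1.
exact: trigpoly_cos_kernel.
Qed.

(* d/dt [sin K_n] = 2(n+1) K_(n+1) - (2n+1) K_n integrates to 0 over a period. *)
Lemma cos_kernel_integralS n x :
  2 * n.+1%:R * circle_integral (fun t => cos_kernel n.+1 (t - x)) =
  (2 * n%:R + 1) * circle_integral (fun t => cos_kernel n (t - x)).
Proof.
have ci m : circle_integrable (fun t => cos_kernel m (t - x)).
  exact/circle_integrable_continuous/trigpoly_continuous/cos_kernel_trigpoly.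
have cm m : continuous (fun t => cos_kernel m (t - x)).
  exact/trigpoly_continuous/cos_kernel_trigpoly.
pose G t := 2 * n.+1%:R * cos_kernel n.+1 (t - x) - (2 * n%:R + 1) * cos_kernel n (t - x).
have cG : continuous G.
  have -> : G = fun t => 2 * n.+1%:R * cos_kernel n.+1 (t - x) +
                         - (2 * n%:R + 1) * cos_kernel n (t - x).
    by apply/funext => t; rewrite /G mulNr.
  apply/trigpoly_continuous/trigpolyD; apply: trigpolyM;
    exact: trigpoly_cst || exact: cos_kernel_trigpoly.
apply/eqP; rewrite -subr_eq0 -!circle_integralZ// -circle_integralB; last 2 first.
  exact: circle_integrableZ.
  exact: circle_integrableZ.
suff dG t : is_derive t 1 (fun t => sin (t - x) * cos_kernel n (t - x)) (G t).
  rewrite (circle_integral_FTC cG dG) -(sinD2piE (0 - x)) /cos_kernel -(cosD2piE (0 - x)).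
  by rewrite add0r (addrC (- x)) subrr.
rewrite /G /cos_kernel; derive.
have s2 : sin (t - x) ^+ 2 = 1 - cos (t - x) ^+ 2 by exact: sin2cos2.
(* The power rule leaves the exponent [n.-1], so n = 0 is treated apart. *)
clear G cG ci cm; case: n => [|n] /=; first by rewrite !expr0; lra.
rewrite !exprS -natr1.
set b := _ ^+ n.
set S := sin _ in s2 *; set C := cos _ in s2 *.
have -> : n.+2%:R = n%:R + 2 :> R by rewrite -addn2 natrD.
transitivity (C * ((1 + C) / 2) * b - (n%:R + 1) * (S ^+ 2) * b / 2).
  by field.
by rewrite s2; field.
Qed.

(** Translation invariance by induction on n: the recursion has the same coefficients for every x,
    and at n = 0 the kernel is constant. *)
Lemma cos_kernel_integral n x :
  circle_integral (fun t => cos_kernel n (t - x)) = kernel_mass n.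
Proof.
have -> : kernel_mass n = circle_integral (fun t => cos_kernel n (t - 0)).
  by congr circle_integral; apply/funext => t; rewrite subr0.
elim: n => [|n IH]; first by congr circle_integral; apply/funext => t; rewrite /cos_kernel !expr0.
apply: (@mulfI _ (2 * n.+1%:R)); first by rewrite mulf_neq0// pnatr_eq0.
by rewrite !cos_kernel_integralS IH.
Qed.

Lemma kernel_massS n : kernel_mass n.+1 = (2 * n%:R + 1) / (2 * n.+1%:R) * kernel_mass n.
Proof.
have := cos_kernel_integralS n 0; rewrite !cos_kernel_integral => h.
have n0 : 2 * n.+1%:R != 0 :> R by rewrite mulf_neq0// pnatr_eq0.
by apply: (mulfI n0); rewrite h mulrA mulrCA mulfV// mulr1.
Qed.

Lemma kernel_mass_gt0 n : 0 < kernel_mass n.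
Proof.
elim: n => [|n IH].
  rewrite /kernel_mass (_ : cos_kernel 0 = fun=> 1); last exact/funext.
  by rewrite circle_integral_cst mulr1 twopi_gt0.
by rewrite kernel_massS mulr_gt0// divr_gt0// ltr_wpDl// mulr_ge0.
Qed.

Lemma mollify_trigpoly n f : circle_integrable f -> trigpoly (mollify n f).
Proof. exact: (separable_integral (separable_cos_kernel _ _)). Qed.

Lemma mollify_integrable n f x : circle_integrable f ->
  circle_integrable (fun t => f t * (cos_kernel n (x - t) / kernel_mass n)).
Proof. by move=> fi; exact/circle_integrable_trigpoly/trigpoly_cos_kernel. Qed.

Lemma mollify_cst n (c : R) x : mollify n (fun=> c) x = c.
Proof.
have -> : mollify n (fun=> c) x =
    circle_integral (fun t => c / kernel_mass n * cos_kernel n (t - x)).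
  by congr circle_integral; apply/funext => t; rewrite cos_kernelB; ring.
rewrite circle_integralZ ?cos_kernel_integral ?divfK ?gt_eqF ?kernel_mass_gt0//.
exact/circle_integrable_continuous/trigpoly_continuous/cos_kernel_trigpoly.
Qed.

Lemma mollifyD n f g x : circle_integrable f -> circle_integrable g ->
  mollify n (fun t => f t + g t) x = mollify n f x + mollify n g x.
Proof.
move=> fi gi; rewrite /mollify -circle_integralD; [|exact: mollify_integrable..].
by congr circle_integral; apply/funext => t; rewrite mulrDl.
Qed.

Lemma mollifyZ n (c : R) f x : circle_integrable f ->
  mollify n (fun t => c * f t) x = c * mollify n f x.
Proof.
move=> fi; rewrite /mollify -circle_integralZ; last exact: mollify_integrable.
by congr circle_integral; apply/funext => t; rewrite -mulrA.
Qed.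

Lemma le_mollify n f g x : circle_integrable f -> circle_integrable g ->
  (forall t, t \in `[0, 2 * pi] -> f t <= g t) -> mollify n f x <= mollify n g x.
Proof.
move=> fi gi fg; apply: le_circle_integral => [||t t2].
- exact: mollify_integrable.
- exact: mollify_integrable.
rewrite ler_wpM2r ?fg// divr_ge0 ?cos_kernel_ge0//.
exact/ltW/kernel_mass_gt0.
Qed.

Lemma circle_integral_mollify n f : circle_integrable f ->
  circle_integral (mollify n f) = circle_integral f.
Proof.
move=> fi; have [_ ->] := separable_fubini (separable_cos_kernel n (kernel_mass n)^-1) fi.
congr circle_integral; apply/funext => t; rewrite -[RHS]mulr1; congr (_ * _).
have -> : (fun x => cos_kernel n (x - t) / kernel_mass n) =
          (fun x => (kernel_mass n)^-1 * cos_kernel n (x - t)).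
  by apply/funext => x; rewrite mulrC.
rewrite circle_integralZ ?cos_kernel_integral ?mulVf ?gt_eqF ?kernel_mass_gt0//.
exact/circle_integrable_continuous/trigpoly_continuous/cos_kernel_trigpoly.
Qed.

(** Jensen's inequality for a probability kernel: the average of (f - m)^2, where m is the average
    of f, is nonnegative. *)
Lemma mollify_sqr_le n f x : circle_integrable f -> circle_integrable (fun t => f t ^+ 2) ->
  mollify n f x ^+ 2 <= mollify n (fun t => f t ^+ 2) x.
Proof.
move=> fi f2i; set m := mollify n f x.
have ci (c : R) : circle_integrable (fun=> c).
  by apply: circle_integrable_continuous => y; exact: cst_continuous.
have f2D : circle_integrable (fun t => f t ^+ 2 + (- (2 * m)) * f t).
  by apply: circle_integrableD => //; exact: circle_integrableZ.
have : mollify n (fun=> 0) x <= mollify n (fun t => f t ^+ 2 + (- (2 * m)) * f t + m ^+ 2) x.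
  apply: le_mollify => //; first exact: circle_integrableD.
  by move=> t _; have := sqr_ge0 (f t - m); lra.
rewrite mollifyD// mollifyD// ?mollifyZ// ?mollify_cst -/m; last exact: circle_integrableZ.
by lra.
Qed.

(** The kernel depends on x - t, so its x-derivative is minus its t-derivative. As a function of t
    it is a smooth test function, and the weak derivative moves the differentiation onto u. *)
Lemma mollify_derive n (u du : R -> R) x :
  circle_integrable u -> circle_integrable du -> weak_derivative u du ->
  is_derive x 1 (mollify n u) (mollify n du x).
Proof.
move=> ui dui wu.
have sk := separable_cos_kernel n (kernel_mass n)^-1.
have [k' [sk' dk dI]] := separable_derive sk.
apply: (is_derive_eq (dI u ui x)).
have [kp _ dkp] := trigpoly_derive (trigpoly_cos_kernel n 0 (kernel_mass n)^-1).
have kE : (fun t => cos_kernel n (0 - t) / kernel_mass n) =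
          (fun t => cos_kernel n t / kernel_mass n).
  by apply/funext => t; rewrite cos_kernelB subr0.
rewrite kE in dkp.
(* Both are x-derivatives of the same kernel, hence equal. *)
have k'E t : k' x t = kp (x - t).
  have h : is_derive x 1 (fun x => cos_kernel n (x - t) / kernel_mass n) (kp (x - t)).
    apply: (is_derive_eq (is_derive_funC (g := fun x => x - t) (b := 1) _ (dkp (x - t)))).
      by derive; ring.
    by rewrite mulr1.
  by have := @derive_val _ _ _ _ _ _ _ h; rewrite (@derive_val _ _ _ _ _ _ _ (dk x t)).
have dphi t : is_derive t 1 (fun t => cos_kernel n (x - t) / kernel_mass n) (- k' x t).
  apply: (is_derive_eq (is_derive_funC (g := fun t => x - t) (b := -1) _ (dkp (x - t)))).
    by derive; ring.
  by rewrite k'E mulrN1.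
have := wu _ (trigpoly_smooth (trigpoly_cos_kernel n x (kernel_mass n)^-1)).
rewrite (is_derive_derive1 dphi) /mollify => /(congr1 -%R); rewrite opprK => <-.
rewrite -mulN1r -circle_integralZ.
  by congr circle_integral; apply/funext => t; rewrite mulN1r mulrN opprK.
have -> : (fun t => u t * - k' x t) = (fun t => - (u t * k' x t)).
  by apply/funext => t; rewrite mulrN.
by apply/circle_integrableN/circle_integrable_trigpoly => //; exact: separable_trigpoly.
Qed.

(** Writing K_n for the kernel, (1 - cos) K_n = 2 K_n - 2 K_(n+1), and the mass ratio (2n+1)/(2n+2)
    leaves 1/(n+1). *)
Lemma mollify_kernel_moment n (C e : R) x :
  mollify n (fun t => e + C * (1 - cos (x - t))) x = e + C / n.+1%:R.
Proof.
have cI m : circle_integrable (fun t => cos_kernel m (t - x)).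
  exact/circle_integrable_continuous/trigpoly_continuous/cos_kernel_trigpoly.
have mE : circle_integral (fun t => cos_kernel n.+1 (t - x)) = kernel_mass n.+1.
  exact: cos_kernel_integral.
have -> : mollify n (fun t => e + C * (1 - cos (x - t))) x =
  circle_integral (fun t => (e + 2 * C) / kernel_mass n * cos_kernel n (t - x) -
                            2 * C / kernel_mass n * cos_kernel n.+1 (t - x)).
  congr circle_integral; apply/funext => t.
  rewrite cos_kernelS -(cosN (t - x)) opprB cos_kernelB; field.
  by rewrite gt_eqF ?kernel_mass_gt0.
rewrite circle_integralB; [|exact: circle_integrableZ..].
rewrite !circle_integralZ// !cos_kernel_integral kernel_massS.
have -> : n%:R = n.+1%:R - 1 :> R by rewrite -natr1 addrK.
have : n.+1%:R != 0 :> R by rewrite pnatr_eq0.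
have : kernel_mass n != 0 by rewrite gt_eqF ?kernel_mass_gt0.
move: (n.+1%:R : R) (kernel_mass n) => N m m0 N0; field.
by rewrite m0 N0.
Qed.

(** By [circle_modulus], f(t) lies within e/2 + C (1 - cos(x - t)) of f(x). Averaging bounds the
    error by e/2 + C/(n+1), uniformly in x. *)
Lemma mollify_cvg f (e : R) : continuous f -> circle_fun f -> 0 < e ->
  exists N, forall n x, (N <= n)%N -> x \in `[0, 2 * pi] -> `|mollify n f x - f x| <= e.
Proof.
move=> cf pf e0; have e2 : 0 < e / 2 by rewrite divr_gt0.
have [C C0 fC] := circle_modulus cf pf e2.
have fi := circle_integrable_continuous cf.
have cosi x : circle_integrable (fun t => e / 2 + C * (1 - cos (x - t))).
  apply/circle_integrable_continuous/is_derive_continuous => t; derive; reflexivity.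
exists (Num.bound (2 * C / e)) => n x nN xC.
have Cn : C / n.+1%:R <= e / 2.
  have : 2 * C / e < n.+1%:R.
    rewrite (lt_le_trans (archi_boundP _))//; first by rewrite divr_ge0 ?(ltW e0)// mulr_ge0.
    by rewrite ler_nat ltnW.
  rewrite ltr_pdivrMr// ler_pdivrMr ?ltr0n//; lra.
have ci (c : R) : circle_integrable (fun=> c).
  by apply: circle_integrable_continuous => y; exact: cst_continuous.
have ub : mollify n f x <= mollify n (fun t => f x + (e / 2 + C * (1 - cos (x - t)))) x.
  apply: le_mollify => //; first exact: circle_integrableD.
  by move=> t tC; have := fC x t xC tC; rewrite ler_norml; lra.
have lb : mollify n (fun t => f x + -1 * (e / 2 + C * (1 - cos (x - t)))) x <= mollify n f x.
  apply: le_mollify => //; first by apply: circle_integrableD => //; exact: circle_integrableZ.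
  by move=> t tC; have := fC x t xC tC; rewrite ler_norml; lra.
rewrite mollifyD// mollify_cst mollify_kernel_moment in ub.
rewrite mollifyD ?mollifyZ ?mollify_cst ?mollify_kernel_moment// in lb; last exact: circle_integrableZ.
move: Cn ub lb; set Q := C / _ => Cn ub lb.
by rewrite ler_norml; apply/andP; split; lra.
Qed.

End mollification.

(** * The inequality *)

Section continuity_rules.
Set Implicit Arguments.
Unset Strict Implicit.
Context {R : realType}.
Implicit Types f g : R -> R.

Lemma continuous_funD f g : continuous f -> continuous g ->
  continuous (fun x => f x + g x).
Proof. by move=> cf cg x; apply: cvgD; [exact: cf|exact: cg]. Qed.

Lemma continuous_funN f : continuous f -> continuous (fun x => - f x).
Proof. by move=> cf x; apply: cvgN; exact: cf. Qed.

Lemma continuous_funM f g : continuous f -> continuous g ->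
  continuous (fun x => f x * g x).
Proof. by move=> cf cg x; apply: cvgM; [exact: cf|exact: cg]. Qed.

Lemma continuous_funX f n : continuous f -> continuous (fun x => f x ^+ n).
Proof.
move=> cf; elim: n => [|n IH]; first by move=> x; exact: cst_continuous.
have -> : (fun x => f x ^+ n.+1) = (fun x => f x * f x ^+ n).
  by apply/funext => x; rewrite exprS.
exact: continuous_funM.
Qed.

Lemma continuous_funV f : (forall x, f x != 0) -> continuous f ->
  continuous (fun x => (f x)^-1).
Proof. by move=> f0 cf x; apply: cvgV; [exact: f0|exact: cf]. Qed.

Lemma continuous_funC f g : continuous f -> continuous g ->
  continuous (fun x => f (g x)).
Proof. by move=> cf cg x; apply: (continuous_comp (cg x)); exact: cf. Qed.

Lemma continuous_fun_cst (c : R) : continuous (fun _ : R => c).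
Proof. by move=> x; exact: cst_continuous. Qed.

Lemma continuous_fun_id : continuous (fun x : R => x).
Proof. by move=> x; exact: cvg_id. Qed.

End continuity_rules.

(** Inverses leave nonvanishing goals, closed by [by] from hypotheses stated beforehand in matching
    form, such as [u2n0]. *)
Ltac cont_step := lazymatch goal with
  | |- continuous (fun y => y) => exact: continuous_fun_id
  | |- continuous (fun y => @?f y + @?g y) => apply: (@continuous_funD _ f g)
  | |- continuous (fun y => - @?f y) => apply: (@continuous_funN _ f)
  | |- continuous (fun y => @?f y * @?g y) => apply: (@continuous_funM _ f g)
  | |- continuous (fun y => @?f y ^+ ?n) => apply: (@continuous_funX _ f n)
  | |- continuous (fun y => (@?f y)^-1) =>
      first [exact: continuous_fun_cst | apply: (@continuous_funV _ f)]
  | |- continuous (fun y => cos (@?f y)) =>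
      apply: (@continuous_funC _ _ f); [exact: continuous_cos|]
  | |- continuous (fun y => sin (@?f y)) =>
      apply: (@continuous_funC _ _ f); [exact: continuous_sin|]
  | |- continuous _ => first [assumption | exact: continuous_fun_cst]
  end.

Ltac cont := repeat cont_step.

(** * Wirtinger's inequality and the bound for continuously differentiable u *)

Section smooth_inequality.
Set Implicit Arguments.
Unset Strict Implicit.
Context {R : realType}.
Implicit Types (x b m : R).
Local Opaque circle_integral.

(* Jacobi's form of the second variation: for m < 1/2 the tangent below is
   regular on the whole closed period, and
   z'^2 - m^2 z^2 = (z' + m z tan)^2 - (m z^2 tan)'. *)
Lemma jacobi_lt_half (z dz A B : R -> R) b m : 0 < m -> m < 1 / 2 ->
  (forall x, is_derive x 1 z (dz x)) -> z b = 0 -> z (b + 2 * pi) = 0 ->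
  (forall x, is_derive x 1 A (dz x ^+ 2)) ->
  (forall x, is_derive x 1 B (z x ^+ 2)) ->
  m ^+ 2 * (B (b + 2 * pi) - B b) <= A (b + 2 * pi) - A b.
Proof.
move=> m0 m2 dzE zb zb2 dA dB; have pi0 := pi_gt0 R.
pose F x := A x - m ^+ 2 * B x + m * (z x ^+ 2 * tan (m * (x - b - pi))).
pose dF x := (dz x + m * (z x * tan (m * (x - b - pi)))) ^+ 2.
(* The argument stays in [-m pi, m pi], strictly inside (-pi/2, pi/2) because m < 1/2. *)
have cosn0 x : x \in `[b, b + 2 * pi] -> cos (m * (x - b - pi)) != 0.
  rewrite in_itv/= => /andP[bx xb]; rewrite gt_eqF// cos_gt0_pihalf//; nra.
have : F b <= F (b + 2 * pi).
  apply: (is_derive_ge0_nondecreasing (df := dF)); first by lra.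
    move=> x xb; rewrite /F /dF; derive; first exact: cosn0.
    rewrite cos2_tan2 ?cosn0//=; ring.
  by move=> x _; exact: sqr_ge0.
rewrite /F zb zb2; lra.
Qed.

(** At m = 1/2 the tangent blows up at both ends, so this is the limit of the bounds for m = 1/2 -
    h. *)
Lemma jacobi_half (z dz A B : R -> R) b :
  (forall x, is_derive x 1 z (dz x)) -> z b = 0 -> z (b + 2 * pi) = 0 ->
  (forall x, is_derive x 1 A (dz x ^+ 2)) ->
  (forall x, is_derive x 1 B (z x ^+ 2)) ->
  (B (b + 2 * pi) - B b) / 4 <= A (b + 2 * pi) - A b.
Proof.
move=> dzE zb zb2 dA dB.
set D := B _ - _; have D0 : 0 <= D.
  rewrite /D subr_ge0; apply: (is_derive_ge0_nondecreasing (f := B) (df := fun x => z x ^+ 2)).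
  - by have := pi_gt0 R; lra.
  - by move=> x _; exact: sqr_ge0.
apply/ler_addgt0Pr => e e0.
(* Replacing 1/4 by (1/2 - h)^2 costs at most h D <= e. The term 4e forces h <= 1/4 and keeps the
   denominator positive when D = 0. *)
pose h := e / (D + 4 * e).
have De : 0 < D + 4 * e by lra.
have hE : h * (D + 4 * e) = e by rewrite /h divfK// gt_eqF.
have h0 : 0 < h by rewrite divr_gt0.
have h4 : h <= 1 / 4 by rewrite /h ler_pdivrMr//; lra.
have h20 : 0 < 1 / 2 - h by lra.
have h22 : 1 / 2 - h < 1 / 2 by lra.
have := jacobi_lt_half h20 h22 dzE zb zb2 dA dB; rewrite -/D => H.
nra.
Qed.

(** F(x + 2 pi) - F(x) has derivative 0. This lets the period of integration start at a zero b of
    the function under study. *)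
Lemma periodic_primitive_increment (F f : R -> R) b :
  (forall x, is_derive x 1 F (f x)) -> circle_fun f ->
  F (b + 2 * pi) - F b = F (2 * pi) - F 0.
Proof.
move=> dF pf; rewrite -[2 * pi in RHS]add0r.
apply: (@is_derive_eq0_cst R (fun x => F (x + 2 * pi) - F x)) => x.
apply: (is_derive_eq (is_derive_funD (is_derive_funC (g := fun x => x + 2 * pi) (b := 1) _
  (dF (x + 2 * pi))) (is_derive_funN (dF x)))).
  by derive; ring.
by rewrite pf mulr1 subrr.
Qed.

(** Antiperiodicity supplies the second zero b + 2 pi and makes z^2 and z'^2 periodic, so the
    Dirichlet inequality on [b, b + 2 pi] transfers to [0, 2 pi]. *)
Lemma wirtinger_antiperiodic (z dz : R -> R) b :
  (forall x, is_derive x 1 z (dz x)) -> continuous dz ->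
  (forall x, z (x + 2 * pi) = - z x) -> z b = 0 ->
  0 <= circle_integral (fun x => dz x ^+ 2 - 1 / 4 * z x ^+ 2).
Proof.
move=> dzE cdz az zb; have cz := is_derive_continuous dzE.
have adz x : dz (x + 2 * pi) = - dz x.
  have h1 : is_derive x 1 (fun x => z (x + 2 * pi)) (dz (x + 2 * pi)).
    apply: (is_derive_eq (is_derive_funC (g := fun x => x + 2 * pi) (b := 1) _ (dzE (x + 2 * pi)))).
      by derive; ring.
    by rewrite mulr1.
  have h2 : is_derive x 1 (fun x => z (x + 2 * pi)) (- dz x).
    rewrite (_ : (fun x => z (x + 2 * pi)) = (fun x => - z x)); last exact/funext.
    exact: is_derive_funN.
  by rewrite -(@derive_val _ _ _ _ _ _ _ h1) (@derive_val _ _ _ _ _ _ _ h2).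
have [A dA] : exists F : R -> R, forall x, is_derive x 1 F (dz x ^+ 2).
  by apply: continuous_primitive; cont.
have [B dB] : exists F : R -> R, forall x, is_derive x 1 F (z x ^+ 2).
  by apply: continuous_primitive; cont.
have dAB x : is_derive x 1 (fun x => A x + (- (1 / 4)) * B x) (dz x ^+ 2 - 1 / 4 * z x ^+ 2).
  by derive; ring.
rewrite (circle_integral_FTC _ dAB); last by cont.
rewrite -(@periodic_primitive_increment _ _ b dAB); last first.
  by move=> x; rewrite adz az !sqrrN.
have := jacobi_half dzE zb _ dA dB; rewrite az zb oppr0 => /(_ erefl); lra.
Qed.

Lemma circle_integral_gt0 (f : R -> R) : continuous f -> (forall x, 0 < f x) ->
  0 < circle_integral f.
Proof.
move=> cf f0; have [c _ fc] := EVT_min (ltW (@twopi_gt0 R)) (continuous_subspaceT cf).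
apply: (@lt_le_trans _ _ (2 * pi * f c)); first by rewrite mulr_gt0 ?twopi_gt0.
rewrite -circle_integral_cst; apply: le_circle_integral => //.
  exact/circle_integrable_continuous/continuous_fun_cst.
exact: circle_integrable_continuous.
Qed.

(* In polar form z = (u cos T, u sin T) with T' = k u^-2 the curve is antiperiodic
   and |z'|^2 - |z|^2/4 = u'^2 - u^2/4 + k^2 u^-2; each of two orthogonal
   projections of z has a zero, which is all that Wirtinger's inequality needs. *)
Lemma smooth_circle_inequality (u du : R -> R) :
  (forall x, is_derive x 1 u (du x)) -> continuous du -> circle_fun u ->
  (forall x, 0 < u x) ->
  - pi ^+ 2 <= circle_integral (fun x => du x ^+ 2 - 1 / 4 * u x ^+ 2) *
               circle_integral (fun x => u x ^- 2).
Proof.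
move=> duE cdu pu u0; have cu := is_derive_continuous duE.
have un0 x : u x != 0 by rewrite gt_eqF.
have u2n0 x : u x ^+ 2 != 0 by rewrite expf_neq0.
have cuV : continuous (fun x => u x ^- 2) by cont.
have [V dV] := continuous_primitive cuV.
pose L := circle_integral (fun x => u x ^- 2).
have LE : L = V (2 * pi) - V 0 by rewrite /L (circle_integral_FTC cuV dV).
have L0 : 0 < L by apply: circle_integral_gt0 => // x; rewrite invr_gt0 exprn_gt0.
pose k := pi / L; have kL : k * L = pi by rewrite divfK// gt_eqF.
have pi0 := pi_gt0 R.
have Vshift x : k * V (x + 2 * pi) = k * V x + pi.
  have pV : circle_fun (fun x => u x ^- 2) by move=> y; rewrite pu.
  have := periodic_primitive_increment x dV pV; rewrite -LE => VL.
  move: kL; rewrite -[in k * L]VL mulrBr; lra.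
(* The projection of the curve, with T = k V, on the direction of angle c + pi/2; it vanishes
   exactly where sin(T - c) does. *)
pose z c x := u x * sin (k * V x - c).
pose dz c x := du x * sin (k * V x - c) + k * (u x)^-1 * cos (k * V x - c).
have dzE c x : is_derive x 1 (z c) (dz c x).
  rewrite /z /dz; derive; field; exact: un0.
have cV := is_derive_continuous dV.
have cz c : continuous (z c) by exact: is_derive_continuous (dzE c).
have cdz c : continuous (dz c) by rewrite /dz; cont.
have az c x : z c (x + 2 * pi) = - z c x.
  by rewrite /z pu Vshift addrAC sinDpi mulrN.
have W c b : k * V b = c -> 0 <= circle_integral (fun x => dz c x ^+ 2 - 1 / 4 * z c x ^+ 2).
  move=> kVb; apply: (wirtinger_antiperiodic (b := b) (dzE c) (cdz c) (az c)).
  by rewrite /z kVb subrr sin0 mulr0.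
(* The first projection vanishes at 0. For the orthogonal one, T rises from c0 to c0 + pi over a
   period and so takes the value c1. *)
pose c0 := k * V 0; pose c1 := c0 + pi / 2.
have [b1 _ b1E] : exists2 b1, b1 \in `[0, 2 * pi] & k * V b1 = c1.
  have ckV : continuous (fun x => k * V x) by cont.
  apply: (IVT (ltW (@twopi_gt0 R)) (continuous_subspaceT ckV)).
  rewrite -[2 * pi]add0r Vshift -/c0 /c1 ge_min le_max; apply/andP; split; apply/orP.
    by left; rewrite lerDl divr_ge0 ?(ltW pi0).
  by right; rewrite lerD2l; lra.
have W0 := W c0 0 erefl; have W1 := W c1 b1 b1E.
have ci (f : R -> R) : continuous f -> circle_integrable f.
  exact: circle_integrable_continuous.
have S : circle_integral (fun x => dz c0 x ^+ 2 - 1 / 4 * z c0 x ^+ 2) +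
         circle_integral (fun x => dz c1 x ^+ 2 - 1 / 4 * z c1 x ^+ 2) =
         circle_integral (fun x => du x ^+ 2 - 1 / 4 * u x ^+ 2) + k ^+ 2 * L.
  rewrite -circle_integralZ; last exact: ci.
  rewrite -!circle_integralD; last first.
  - by apply: ci; have := cdz c0; have := cz c0; move=> ? ?; cont.
  - by apply: ci; have := cdz c1; have := cz c1; move=> ? ?; cont.
  - by apply: ci; cont.
  - by apply: ci; cont.
  congr circle_integral; apply/funext => x.
  have -> : dz c1 x = du x * - cos (k * V x - c0) + k * (u x)^-1 * sin (k * V x - c0).
    by rewrite /dz /c1 opprD addrA cosBpihalf sinBpihalf.
  have -> : z c1 x = u x * - cos (k * V x - c0).
    by rewrite /z /c1 opprD addrA sinBpihalf.
  rewrite /dz /z.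
  have -> : u x ^- 2 = (u x)^-1 ^+ 2 by rewrite exprVn.
  have := cos2Dsin2 (k * V x - c0); move: (u x)^-1 => v.
  move: (cos _) (sin _) => C S CS.
  transitivity (du x ^+ 2 * (C ^+ 2 + S ^+ 2) - 1 / 4 * u x ^+ 2 * (C ^+ 2 + S ^+ 2)
    + k ^+ 2 * v ^+ 2 * (C ^+ 2 + S ^+ 2)); first by field.
  by rewrite CS; ring.
have := addr_ge0 W0 W1; rewrite S -/L => h.
have : 0 <= (circle_integral (fun x => du x ^+ 2 - 1 / 4 * u x ^+ 2) + k ^+ 2 * L) * L.
  by rewrite mulr_ge0// ltW.
rewrite mulrDl -mulrA -!expr2 -exprMn kL -/L.
set X := _ * L; lra.
Qed.

End smooth_inequality.

(** * From mollified functions to general u *)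

Section circle_inequality.
Set Implicit Arguments.
Unset Strict Implicit.
Context {R : realType}.
Implicit Types (x : R).
Local Opaque circle_integral.

Lemma circle_integrable_cst (c : R) : circle_integrable (fun=> c).
Proof. exact/circle_integrable_continuous/continuous_fun_cst. Qed.

Lemma mollify_ge n (f : R -> R) (m x : R) : circle_integrable f ->
  (forall t, t \in `[0, 2 * pi] -> m <= f t) -> m <= mollify n f x.
Proof.
move=> fi mf; rewrite -[leLHS](mollify_cst n m x).
by apply: le_mollify => //; exact: circle_integrable_cst.
Qed.

Lemma mollify_le n (f : R -> R) (m x : R) : circle_integrable f ->
  (forall t, t \in `[0, 2 * pi] -> f t <= m) -> mollify n f x <= m.
Proof.
move=> fi mf; rewrite -[leRHS](mollify_cst n m x).
by apply: le_mollify => //; exact: circle_integrable_cst.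
Qed.

Lemma mollify_sqr_cvg (u : R -> R) (e : R) : continuous u -> circle_fun u ->
  (forall x, 0 < u x) -> 0 < e ->
  exists n, forall x, x \in `[0, 2 * pi] ->
    `|mollify n u x ^+ 2 - u x ^+ 2| <= e /\
    `|mollify n u x ^- 2 - u x ^- 2| <= e.
Proof.
move=> cu pu u0 e0; have ui := circle_integrable_continuous cu.
have tp0 := ltW (@twopi_gt0 R).
have [a _ amin] := EVT_min tp0 (continuous_subspaceT cu).
have [b _ bmax] := EVT_max tp0 (continuous_subspaceT cu).
set m := u a in amin; set M := u b in bmax.
have m0 : 0 < m by exact: u0. have M0 : 0 < M by exact: u0.
have mx n x := mollify_ge n x ui amin.
have Mx n x := mollify_le n x ui bmax.
(* The mollified v also lies in [m, M], so |v^2 - u^2| <= 2 M |v - u|. The difference of inverse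
   squares divides this by v^2 u^2 >= m^4. *)
pose d := Num.min e (e * m ^+ 4) / (2 * M).
have m40 : 0 < m ^+ 4 by rewrite exprn_gt0.
have d0 : 0 < d by rewrite divr_gt0 ?mulr_gt0// lt_min e0 mulr_gt0.
have d1 : d * (2 * M) <= e by rewrite divfK ?mulf_neq0 ?gt_eqF// ge_min lexx.
have d2 : d * (2 * M) <= e * m ^+ 4.
  by rewrite divfK ?mulf_neq0 ?gt_eqF// ge_min lexx orbT.
have [N HN] := mollify_cvg cu pu d0; exists N => x xC.
have {}HN := HN N x (leqnn _) xC.
have [m1 M1] := (mx N x, Mx N x).
have [m2 M2] := (amin x xC, bmax x xC).
set v := mollify N u x in HN m1 M1 *.
have h : `|v ^+ 2 - u x ^+ 2| <= d * (2 * M).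
  rewrite subr_sqr normrM ler_pM// ger0_norm; lra.
split; first exact: le_trans d1.
have v0 : 0 < v by exact: lt_le_trans m1.
have -> : v ^- 2 - u x ^- 2 = - (v ^+ 2 - u x ^+ 2) / (v ^+ 2 * u x ^+ 2).
  by field; rewrite !gt_eqF.
have vu : m ^+ 4 <= v ^+ 2 * u x ^+ 2.
  have -> : m ^+ 4 = m ^+ 2 * m ^+ 2 by ring.
  by rewrite ler_pM ?sqr_ge0// lerXn2r ?nnegrE// ltW.
have vu0 : 0 < v ^+ 2 * u x ^+ 2 by rewrite mulr_gt0 ?exprn_gt0.
rewrite normrM normrN normfV (gtr0_norm vu0) ler_pdivrMr//.
rewrite (le_trans h)// (le_trans d2)// ler_wpM2l// ltW//.
Qed.

(** Only an upper bound on the mollified product is at stake, so [Dn <= D] replaces any convergence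
    of derivatives; u^2 and u^-2 converge uniformly. *)
Lemma circle_inequality (u du : R -> R) : continuous u -> circle_fun u ->
  (forall x, 0 < u x) -> L2_circle du -> weak_derivative u du ->
  - pi ^+ 2 <= circle_integral (fun x => du x ^+ 2 - 1 / 4 * u x ^+ 2) *
               circle_integral (fun x => u x ^- 2).
Proof.
move=> cu pu u0 L2du wu.
have ci (f : R -> R) : continuous f -> circle_integrable f.
  exact: circle_integrable_continuous.
have ui := ci _ cu; have dui := L2_circle_integrable L2du.
have du2i : circle_integrable (fun x => du x ^+ 2) by case: L2du.
have u2n0 x : u x ^+ 2 != 0 by rewrite expf_neq0// gt_eqF.
have u2i : circle_integrable (fun x => u x ^+ 2) by apply: ci; cont.
have uVi : circle_integrable (fun x => u x ^- 2) by apply: ci; cont.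
have qu2i : circle_integrable (fun x => 1 / 4 * u x ^+ 2) by exact: circle_integrableZ.
rewrite circle_integralB// circle_integralZ//.
have L0 : 0 < circle_integral (fun x => u x ^- 2).
  by apply: circle_integral_gt0 => [|x]; [cont|rewrite invr_gt0 exprn_gt0].
set D := circle_integral _; set U := circle_integral _; set L := circle_integral _ in L0 *.
apply/ler_addgt0Pr => e e0.
(* If the integrals of u^2 and u^-2 move by at most p <= 1, the product grows by at most p q.
   Dividing p by 2 pi below gives the matching uniform tolerance. *)
pose q := `|D - 1 / 4 * U| + L + 1.
have q0 : 0 < q by rewrite /q; have := normr_ge0 (D - 1 / 4 * U); lra.
pose p := Num.min 1 (e / q).
have p0 : 0 < p by rewrite lt_min ltr01 divr_gt0.
have p1 : p <= 1 by rewrite ge_min lexx.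
have pq : p * q <= e by rewrite -ler_pdivlMr// ge_min lexx orbT.
have eta0 : 0 < p / (2 * pi) by rewrite divr_gt0 ?twopi_gt0.
have [n Hn] := mollify_sqr_cvg cu pu u0 eta0.
pose un := mollify n u; pose dun := mollify n du.
have tun : trigpoly un by exact: mollify_trigpoly.
have cun := trigpoly_continuous tun.
have cdun : continuous dun by exact/trigpoly_continuous/mollify_trigpoly.
have un0 x : 0 < un x.
  have [a _ amin] := EVT_min (ltW (@twopi_gt0 R)) (continuous_subspaceT cu).
  exact: lt_le_trans (u0 a) (mollify_ge n x ui amin).
have un2n0 x : un x ^+ 2 != 0 by rewrite expf_neq0// gt_eqF.
have un2i : circle_integrable (fun x => un x ^+ 2) by apply: ci; cont.
have unVi : circle_integrable (fun x => un x ^- 2) by apply: ci; cont.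
have dun2i : circle_integrable (fun x => dun x ^+ 2) by apply: ci; cont.
have qun2i : circle_integrable (fun x => 1 / 4 * un x ^+ 2) by exact: circle_integrableZ.
have dunE x : is_derive x 1 un (dun x) by exact: mollify_derive.
have := smooth_circle_inequality dunE cdun (trigpoly_circle_fun tun) un0.
rewrite circle_integralB// circle_integralZ//.
have Ln0 : 0 < circle_integral (fun x => un x ^- 2).
  by apply: circle_integral_gt0 => [|x]; [cont|rewrite invr_gt0 exprn_gt0].
set Dn := circle_integral _; set Un := circle_integral _; set Ln := circle_integral _ in Ln0 *.
move=> ineq.
have DnD : Dn <= D.
  rewrite /Dn /D -(circle_integral_mollify n du2i).
  apply: le_circle_integral => //.
    exact/ci/trigpoly_continuous/mollify_trigpoly.
  by move=> x _; exact: mollify_sqr_le.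
have pE : 2 * pi * (p / (2 * pi)) = p by rewrite mulrC divfK// gt_eqF// twopi_gt0.
have UnU : `|Un - U| <= p.
  rewrite -pE; apply: circle_integral_dist => // x xC.
  by have [] := Hn x xC.
have LnL : `|Ln - L| <= p.
  rewrite -pE; apply: circle_integral_dist => // x xC.
  by have [] := Hn x xC.
move: UnU LnL; rewrite !ler_norml => /andP[U1 U2] /andP[L1 L2].
rewrite (le_trans ineq)//.
pose A := D - 1 / 4 * U.
have h1 : (Dn - 1 / 4 * Un) * Ln <= (A + p / 4) * Ln.
  by rewrite ler_wpM2r ?(ltW Ln0)// /A; lra.
have h2 : A * (Ln - L) <= `|A| * p.
  rewrite (le_trans (ler_norm _))// normrM ler_wpM2l// ler_norml L1//=.
have h3 : p / 4 * Ln <= p * (L + 1) by nra.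
move: pq; rewrite /q -/A; nra.
Qed.

End circle_inequality.

(** * First variation *)

Section first_variation.
Set Implicit Arguments.
Unset Strict Implicit.
Context {R : realType}.
Implicit Types (x : R).
Local Opaque circle_integral.

Lemma circle_fun_intmul (f : R -> R) x (z : int) : circle_fun f ->
  f (x + z%:~R * (2 * pi)) = f x.
Proof.
move=> pf.
have pn n y : f (y + n%:R * (2 * pi)) = f y.
  by elim: n y => [|n IH] y; rewrite ?mul0r ?addr0// -natr1 mulrDl mul1r addrA pf IH.
case: z => n; first by rewrite -pmulrn pn.
by rewrite NegzE mulrNz mulNr -[in RHS](subrK (n.+1%:R * (2 * pi)) x) -pmulrn pn.
Qed.

Lemma circle_fun_reduce x : exists2 y : R, y \in `[0, 2 * pi] &
  forall f : R -> R, circle_fun f -> f x = f y.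
Proof.
have tp0 := @twopi_gt0 R; pose z := Num.floor (x / (2 * pi)).
exists (x - z%:~R * (2 * pi)); last first.
  by move=> f pf; rewrite -[in LHS](subrK (z%:~R * (2 * pi)) x) circle_fun_intmul.
have -> : x - z%:~R * (2 * pi) = (x / (2 * pi) - z%:~R) * (2 * pi).
  by rewrite mulrBl divfK ?gt_eqF.
have z1 : z%:~R <= x / (2 * pi) by exact: floor_le.
have z2 : x / (2 * pi) < z%:~R + 1.
  by rewrite -[1]/(1%:~R) -intrD; exact: floorD1_gt.
rewrite in_itv/=; apply/andP; split; first by rewrite mulr_ge0 ?(ltW tp0)// subr_ge0.
by rewrite ler_piMl ?(ltW tp0)//; lra.
Qed.

Lemma circle_fun_bounded (f : R -> R) : continuous f -> circle_fun f ->
  exists2 M, 0 < M & forall x, `|f x| <= M.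
Proof.
move=> cf pf; have [M M0 fM] := continuous_bounded_circle cf.
exists (M + 1) => [|x]; first by lra.
have [y yC fE] := circle_fun_reduce x; rewrite fE//; have := fM y yC; lra.
Qed.

Lemma circle_fun_pos_lower_bound (f : R -> R) : continuous f -> circle_fun f ->
  (forall x, 0 < f x) -> exists2 m, 0 < m & forall x, m <= f x.
Proof.
move=> cf pf f0; have [a _ amin] := EVT_min (ltW (@twopi_gt0 R)) (continuous_subspaceT cf).
exists (f a) => // x; have [y yC fE] := circle_fun_reduce x.
by rewrite (fE f pf) amin.
Qed.

Lemma is_derive_circle_fun (f df : R -> R) : (forall x, is_derive x 1 f (df x)) ->
  circle_fun f -> circle_fun df.
Proof.
move=> dfE pf x.
have h : is_derive x 1 (fun x => f (x + 2 * pi)) (df (x + 2 * pi)).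
  apply: (is_derive_eq (is_derive_funC (g := fun x => x + 2 * pi) (b := 1) _ (dfE (x + 2 * pi)))).
    by derive; ring.
  by rewrite mulr1.
rewrite (_ : (fun x => f (x + 2 * pi)) = f) in h; last exact/funext.
by rewrite -(@derive_val _ _ _ _ _ _ _ h) (@derive_val _ _ _ _ _ _ _ (dfE x)).
Qed.

Lemma smooth_circle_derive (f : R -> R) : smooth_circle f ->
  [/\ circle_fun f, continuous f, continuous (derive1 f) &
      forall x, is_derive x 1 f (derive1 f x)].
Proof.
move=> [pf sf].
have fE x : is_derive x 1 f (derive1 f x).
  by apply: DeriveDef; [exact: (sf 0%N)|rewrite derive1E].
have dfE x : is_derive x 1 (derive1 f) (derive1 (derive1 f) x).
  by apply: DeriveDef; [exact: (sf 1%N)|rewrite derive1E].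
by split=> //; [exact: is_derive_continuous fE|exact: is_derive_continuous dfE].
Qed.

(** The derivative of the periodic function u phi integrates to 0 over a period. *)
Lemma C1_weak_derivative (u du : R -> R) : (forall x, is_derive x 1 u (du x)) ->
  continuous du -> circle_fun u -> weak_derivative u du.
Proof.
move=> duE cdu pu phi /smooth_circle_derive[pphi cphi cdphi dphi].
have cu := is_derive_continuous duE.
have uphiE x : is_derive x 1 (fun x => u x * phi x) (u x * derive1 phi x + du x * phi x).
  apply: (is_derive_eq (is_derive_funM (duE x) (dphi x))); ring.
have := @circle_integral_FTC R _ _ _ uphiE.
rewrite -[2 * pi]add0r pu pphi subrr circle_integralD; first last.
- by apply: circle_integrable_continuous; cont.
- by apply: circle_integrable_continuous; cont.
move=> h; apply/eqP; rewrite -addr_eq0; apply/eqP; apply: h.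
by cont.
Qed.

Lemma L2_circle_perturbation (f g : R -> R) (e : R) : L2_circle f -> continuous g ->
  circle_fun g -> L2_circle (fun x => f x + e * g x).
Proof.
move=> L2f cg pg; have fi := L2_circle_integrable L2f; case: L2f => pf mf f2i.
have egi : circle_integrable (fun x => e * g x) by apply: circle_integrable_continuous; cont.
split; first by move=> x; rewrite pf pg.
  exact: circle_integrable_measurable (circle_integrableD fi egi).
rewrite (_ : (fun x => _ ^+ 2) =
  (fun x => f x ^+ 2 + (f x * (2 * e * g x) + (e * g x) ^+ 2))); last first.
  by apply/funext => x; ring.
apply: circle_integrableD => //; apply: circle_integrableD.
  by apply: circle_integrableM => //; cont.
by apply: circle_integrable_continuous; cont.
Qed.

Lemma weak_derivativeD (u v du dv : R -> R) (e : R) :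
  circle_integrable u -> circle_integrable v ->
  circle_integrable du -> circle_integrable dv ->
  weak_derivative u du -> weak_derivative v dv ->
  weak_derivative (fun x => u x + e * v x) (fun x => du x + e * dv x).
Proof.
move=> ui vi dui dvi wu wv phi sphi.
have [pphi cphi cdphi dphi] := smooth_circle_derive sphi.
have E (f g h : R -> R) : circle_integrable f -> circle_integrable g -> continuous h ->
    circle_integral (fun x => (f x + e * g x) * h x) =
    circle_integral (fun x => f x * h x) + e * circle_integral (fun x => g x * h x).
  move=> fi gi ch; have ghi := circle_integrableM gi ch.
  rewrite -circle_integralZ// -circle_integralD.
  - by congr circle_integral; apply/funext => x; rewrite mulrDl mulrA.
  - exact: circle_integrableM.
  - exact: circle_integrableZ.
by rewrite !E// wu// wv// opprD mulrN.
Qed.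

(** Evaluating at t and -t and dividing by t > 0 gives |c1| <= |c2| t + |c3| t^2, which is below any
    e > 0 once t is small. *)
Lemma cubic_ge0_linear_coef0 (c1 c2 c3 d : R) : 0 < d ->
  (forall e, `|e| <= d -> 0 <= c1 * e + c2 * e ^+ 2 + c3 * e ^+ 3) -> c1 = 0.
Proof.
move=> d0 H; apply/eqP; rewrite -normr_eq0; apply/eqP/le_anti.
rewrite normr_ge0 andbT; apply/ler_addgt0Pr => e e0; rewrite add0r.
pose q := `|c2| + `|c3| + 1.
have [n2 n3] := (normr_ge0 c2, normr_ge0 c3).
have q0 : 0 < q by rewrite /q; lra.
pose t := Num.min (Num.min d 1) (e / q).
have t0 : 0 < t by rewrite !lt_min d0 ltr01 divr_gt0.
have td : t <= d by rewrite !ge_min lexx.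
have t1 : t <= 1 by rewrite !ge_min lexx orbT.
have tq : t * q <= e by rewrite -ler_pdivlMr// !ge_min lexx orbT.
have c2t : `|c2 * t| <= `|c2| * t by rewrite normrM (gtr0_norm t0).
have c3t : `|c3 * t ^+ 2| <= `|c3| * t.
  by rewrite normrM normrX (gtr0_norm t0) ler_wpM2l// expr2 ler_piMl// ltW.
move: c2t c3t; rewrite !ler_norml => /andP[a1 a2] /andP[a3 a4].
have P1 : 0 <= (c1 + c2 * t + c3 * t ^+ 2) * t.
  have := H t; rewrite (gtr0_norm t0) => /(_ td); nra.
have P2 : 0 <= (- c1 + c2 * t - c3 * t ^+ 2) * t.
  have := H (- t); rewrite normrN (gtr0_norm t0) => /(_ td); nra.
rewrite pmulr_lge0// in P1; rewrite pmulr_lge0// in P2.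
rewrite /q in tq.
by apply/andP; split; lra.
Qed.

(** The tangent line at t; the gap factors explicitly with a double root at s = t. *)
Lemma inv_sqr_convex (s t : R) : 0 < s -> 0 < t -> t ^- 2 - 2 * t ^- 3 * (s - t) <= s ^- 2.
Proof.
move=> s0 t0; rewrite -subr_ge0.
have -> : s ^- 2 - (t ^- 2 - 2 * t ^- 3 * (s - t)) =
    (s - t) ^+ 2 * (2 * s + t) / (s ^+ 2 * t ^+ 3).
  by field; rewrite !gt_eqF.
apply: divr_ge0; apply: mulr_ge0; rewrite ?sqr_ge0 ?exprn_ge0 ?(ltW t0)//; lra.
Qed.

(* Convexity of s^-2 bounds the second factor from below along u + e phi, and the
   first factor is negative there, so the perturbed product is at most a cubic
   polynomial in e, which must stay above its value at e = 0. *)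
Lemma extremal_weak_second_derivative (u du : R -> R) :
  continuous u -> circle_fun u -> (forall x, 0 < u x) -> L2_circle du ->
  weak_derivative u du ->
  circle_integral (fun x => du x ^+ 2 - 1 / 4 * u x ^+ 2) *
    circle_integral (fun x => u x ^- 2) = - pi ^+ 2 ->
  exists k, weak_derivative du (fun x => k ^+ 2 * u x ^- 3 - 1 / 4 * u x).
Proof.
move=> cu pu u0 L2du wu.
have ci (f : R -> R) : continuous f -> circle_integrable f.
  exact: circle_integrable_continuous.
have ui := ci _ cu; have dui := L2_circle_integrable L2du.
have du2i : circle_integrable (fun x => du x ^+ 2) by case: L2du.
have u2n0 x : u x ^+ 2 != 0 by rewrite expf_neq0// gt_eqF.
have u3n0 x : u x ^+ 3 != 0 by rewrite expf_neq0// gt_eqF.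
have u2i : circle_integrable (fun x => u x ^+ 2) by apply: ci; cont.
have uVi : circle_integrable (fun x => u x ^- 2) by apply: ci; cont.
have L0 : 0 < circle_integral (fun x => u x ^- 2).
  by apply: circle_integral_gt0 => [|x]; [cont|rewrite invr_gt0 exprn_gt0].
set A := circle_integral _; set L := circle_integral _ in L0 * => AL.
have pi0 := pi_gt0 R.
have A0 : A < 0.
  rewrite -(pmulr_llt0 _ L0) AL oppr_lt0 exprn_gt0//.
pose k := pi / L; exists k => phi sphi.
have [pphi cphi cdphi dphi] := smooth_circle_derive sphi.
pose psi := derive1 phi; rewrite -/psi in cdphi dphi *.
pose B := circle_integral (fun x => du x * psi x) - 1 / 4 * circle_integral (fun x => u x * phi x).
pose D := circle_integral (fun x => psi x ^+ 2 - 1 / 4 * phi x ^+ 2).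
pose M := circle_integral (fun x => phi x * u x ^- 3).
have dpi : circle_integrable (fun x => du x * psi x) by exact: circle_integrableM.
have upi : circle_integrable (fun x => u x * phi x) by apply: ci; cont.
have Ai : circle_integrable (fun x => du x ^+ 2 - 1 / 4 * u x ^+ 2).
  by apply: circle_integrableB => //; exact: circle_integrableZ.
have Di : circle_integrable (fun x => psi x ^+ 2 - 1 / 4 * phi x ^+ 2) by apply: ci; cont.
have Mi : circle_integrable (fun x => phi x * u x ^- 3) by apply: ci; cont.
have aE e : circle_integral (fun x => (du x + e * psi x) ^+ 2 - 1 / 4 * (u x + e * phi x) ^+ 2) =
    A + 2 * e * B + e ^+ 2 * D.
  have -> : A + 2 * e * B + e ^+ 2 * D =
    A + (2 * e * circle_integral (fun x => du x * psi x) +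
         - (e / 2) * circle_integral (fun x => u x * phi x)) + e ^+ 2 * D.
    by rewrite /B; field.
  have i1 : circle_integrable (fun x => 2 * e * (du x * psi x)) by exact: circle_integrableZ.
  have i2 : circle_integrable (fun x => - (e / 2) * (u x * phi x)) by exact: circle_integrableZ.
  have i3 : circle_integrable (fun x => e ^+ 2 * (psi x ^+ 2 - 1 / 4 * phi x ^+ 2)).
    exact: circle_integrableZ.
  have i12 := circle_integrableD i1 i2; have i012 := circle_integrableD Ai i12.
  rewrite -!circle_integralZ// -!circle_integralD//.
  by congr circle_integral; apply/funext => x; field.
have [m m0 mu] := circle_fun_pos_lower_bound cu pu u0.
have [N N0 phiN] := circle_fun_bounded cphi pphi.
have wphi : weak_derivative phi psi by exact: C1_weak_derivative.
have ppsi : circle_fun psi by exact: is_derive_circle_fun dphi pphi.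
pose Q := 2 * `|B| + `|D| + 1.
have [nB nD] := (normr_ge0 B, normr_ge0 D).
have Q0 : 0 < Q by rewrite /Q; lra.
(* For |e| <= d, the second bound keeps u + e phi >= m/2, and the third, with e^2 <= |e|, keeps A +
   2eB + e^2 D <= 0. *)
pose d := Num.min (Num.min 1 (m / (2 * N))) (- A / Q).
have d0 : 0 < d by rewrite !lt_min ltr01 !divr_gt0 ?mulr_gt0 ?oppr_gt0.
have d1 : d <= 1 by rewrite !ge_min lexx.
have dN : d * (2 * N) <= m by rewrite -ler_pdivlMr ?mulr_gt0// !ge_min lexx orbT.
have dQ : d * Q <= - A by rewrite -ler_pdivlMr// !ge_min lexx orbT.
(* The expansion of (A + 2eB + e^2 D)(L - 2eM) - A L. *)
have cubic e : `|e| <= d -> 0 <= (2 * (B * L - A * M)) * e +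
    (D * L - 4 * B * M) * e ^+ 2 + (- 2 * D * M) * e ^+ 3.
  move=> ed; have e1 : `|e| <= 1 by exact: le_trans d1.
  have ue0 x : 0 < u x + e * phi x.
    have : `|e * phi x| <= d * N by rewrite normrM ler_pM.
    by rewrite ler_norml; have := mu x; lra.
  have ce : continuous (fun x => u x + e * phi x) by cont.
  have ue2n0 x : (u x + e * phi x) ^+ 2 != 0 by rewrite expf_neq0// gt_eqF.
  have pe : circle_fun (fun x => u x + e * phi x) by move=> x; rewrite pu pphi.
  have L2e := @L2_circle_perturbation du psi e L2du cdphi ppsi.
  have we := @weak_derivativeD u phi du psi e ui (ci _ cphi) dui (ci _ cdphi) wu wphi.
  have := circle_inequality ce pe ue0 L2e we; rewrite aE.
  set a := A + _ + _; set Le := circle_integral _ => ineq.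
  have LeL : L + (- (2 * e)) * M <= Le.
    rewrite /L /M -circle_integralZ// -circle_integralD//; last exact: circle_integrableZ.
    apply: le_circle_integral.
    - by apply: circle_integrableD => //; exact: circle_integrableZ.
    - by apply: ci; cont.
    - move=> x _; have := inv_sqr_convex (ue0 x) (u0 x).
      by rewrite addrAC subrr add0r; lra.
  have a0 : a <= 0.
    have h1 : `|2 * e * B| <= d * (2 * `|B|).
      by rewrite !normrM (ger0_norm (ler0n _ 2)) mulrAC mulrC ler_wpM2r// mulr_ge0.
    have h2 : `|e ^+ 2 * D| <= d * `|D|.
      by rewrite normrM normrX ler_wpM2r// expr2 -[leRHS]mulr1 ler_pM.
    move: h1 h2; rewrite !ler_norml /a => /andP[_ h1] /andP[_ h2].
    by move: dQ; rewrite /Q; lra.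
  have : - pi ^+ 2 <= a * (L + (- (2 * e)) * M) by apply: le_trans ineq _; rewrite ler_wnM2l.
  by rewrite -AL /a; lra.
(* The Euler-Lagrange equation tested against phi. Since A L = - (k L)^2, it reads B = - k^2 M. *)
have BLAM : B * L = A * M by have := cubic_ge0_linear_coef0 d0 cubic; lra.
have BE : B = - k ^+ 2 * M.
  apply: (@mulIf _ L); first by rewrite gt_eqF.
  rewrite BLAM; apply: (@mulIf _ L); first by rewrite gt_eqF.
  rewrite mulrAC AL; have <- : k * L = pi by rewrite divfK// gt_eqF.
  by ring.
rewrite -mulN1r -circle_integralZ; last first.
  by apply: ci; cont.
transitivity (B + 1 / 4 * circle_integral (fun x => u x * phi x)); first by rewrite /B subrK.
rewrite BE /M -!circle_integralZ// -circle_integralD; first last.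
- exact: circle_integrableZ.
- exact: circle_integrableZ.
by congr circle_integral; apply/funext => x; ring.
Qed.

End first_variation.

(** * Extremals *)

Section extremals.
Set Implicit Arguments.
Unset Strict Implicit.
Context {R : realType}.
Implicit Types (x y z e : R).
Local Opaque circle_integral.

Lemma mollify_cvg_everywhere (f : R -> R) (e : R) : continuous f -> circle_fun f -> 0 < e ->
  exists N, forall n x, (N <= n)%N -> `|mollify n f x - f x| <= e.
Proof.
move=> cf pf e0; have [N HN] := mollify_cvg cf pf e0; exists N => n x Nn.
have [y yC fE] := circle_fun_reduce x.
have pm : circle_fun (fun x => mollify n f x - f x).
  move=> z; rewrite pf.
  by rewrite (trigpoly_circle_fun (mollify_trigpoly n (circle_integrable_continuous cf))).
by rewrite (fE _ pm); exact: HN.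
Qed.

Lemma is_derive_dist0 (f df : R -> R) (K x : R) : (forall y : R, is_derive y 1 f (df y)) ->
  (forall y : R, `|y| <= `|x| -> `|df y| <= K) -> `|f x - f 0| <= K * `|x|.
Proof.
move=> dfE dfK; have cf := is_derive_continuous dfE.
case: (leP 0 x) => x0.
  have [c cx ->] := MVT_segment x0 (fun y _ => dfE y) (continuous_subspaceT cf).
  move: cx; rewrite in_itv/= subr0 => /andP[c0 cx].
  by rewrite normrM ler_wpM2r// dfK// !ger0_norm.
have [c cx fE] := MVT_segment (ltW x0) (fun y _ => dfE y) (continuous_subspaceT cf).
move: cx; rewrite in_itv/= => /andP[c0 cx].
rewrite distrC fE sub0r normrM normrN ler_wpM2r// dfK//.
by rewrite !ler0_norm// ?lerN2// ltW.
Qed.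

(** With W2'' = w, the claim is that f = u - W2 is affine. As W2 need not be periodic, only u is
    mollified: fn = mollify(u) - W2 has second derivative mollify(w) - w, uniformly small, so fn is
    nearly its tangent at 0. Comparing the points x and 1 eliminates the unknown slope fn'(0), about
    which no convergence is known. *)
Lemma weak_second_derivative_C2 (u du w : R -> R) :
  continuous u -> circle_fun u -> circle_integrable du ->
  continuous w -> circle_fun w ->
  weak_derivative u du -> weak_derivative du w ->
  exists2 v, (forall x, is_derive x 1 u (v x)) & (forall x, is_derive x 1 v (w x)).
Proof.
move=> cu pu dui cw pw wu wdu.
have [W1 dW1] := continuous_primitive cw.
have [W2 dW2] := continuous_primitive (is_derive_continuous dW1).
have ui := circle_integrable_continuous cu; have wi := circle_integrable_continuous cw.
pose f x := u x - W2 x.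
have approx (x e : R) : 0 < e -> `|f x - f 0 - x * (f 1 - f 0)| <= e.
  (* Errors in units of d: x^2 and |x| from the Taylor bounds at x and 1, then 2 + 2|x| from
     replacing fn by f. *)
  move=> e0; pose q := x ^+ 2 + 3 * `|x| + 2; have nx := normr_ge0 x.
  have q0 : 0 < q by rewrite /q; have := sqr_ge0 x; lra.
  have d0 : 0 < e / q by rewrite divr_gt0.
  have [N1 H1] := mollify_cvg_everywhere cu pu d0.
  have [N2 H2] := mollify_cvg_everywhere cw pw d0.
  pose n := maxn N1 N2.
  have {}H1 y := H1 n y (leq_maxl _ _); have {}H2 y := H2 n y (leq_maxr _ _).
  set d := e / q in d0 H1 H2.
  pose fn y := mollify n u y - W2 y.
  pose fn' y := mollify n du y - W1 y.
  have dfn y : is_derive y 1 fn (fn' y).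
    exact: is_derive_funD (mollify_derive n y ui dui wu) (is_derive_funN (dW2 y)).
  have dfn' y : is_derive y 1 fn' (mollify n w y - w y).
    exact: is_derive_funD (mollify_derive n y dui wi wdu) (is_derive_funN (dW1 y)).
  have T y : `|fn y - fn 0 - y * fn' 0| <= d * `|y| * `|y|.
    pose r z := fn z - z * fn' 0.
    have dr z : is_derive z 1 r (fn' z - fn' 0).
      by rewrite /r; derive; ring.
    have := @is_derive_dist0 r (fun z => fn' z - fn' 0) (d * `|y|) y dr.
    rewrite /r mul0r subr0 addrAC; apply => z zy.
    apply: (le_trans (is_derive_dist0 dfn' (fun t _ => H2 t))).
    by rewrite ler_wpM2l// ltW.
  have F y : `|fn y - f y| <= d.
    by rewrite /fn /f opprB addrA addrNK; exact: H1.
  have T1 := T 1; have Tx := T x; have F0 := F 0; have F1 := F 1; have Fx := F x.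
  rewrite mul1r normr1 !mulr1 in T1.
  have -> : f x - f 0 - x * (f 1 - f 0) =
    (fn x - fn 0 - x * fn' 0) - x * (fn 1 - fn 0 - fn' 0)
    - (fn x - f x) + (fn 0 - f 0) + x * (fn 1 - f 1) - x * (fn 0 - f 0) by ring.
  have nM a : `|a| <= d -> `|x * a| <= `|x| * d by move=> h; rewrite normrM ler_wpM2l.
  have := nM _ T1; have := nM _ F1; have := nM _ F0.
  have dq : d * q = e by rewrite divfK// gt_eqF.
  have xx : `|x| * `|x| = x ^+ 2 by rewrite -normrM -expr2 ger0_norm ?sqr_ge0.
  move: dq Tx F0 F1 Fx; rewrite /q -mulrA xx.
  set t0 := fn x - fn 0 - _; set t1 := x * (fn 1 - fn 0 - _); set t2 := fn x - f x.
  set t3 := fn 0 - f 0; set t4 := fn 1 - f 1; set t5 := x * t3; set t6 := x * t4.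
  rewrite !ler_norml; move=> dq /andP[? ?] /andP[? ?] /andP[? ?] /andP[? ?] /andP[? ?] /andP[? ?] /andP[? ?].
  by apply/andP; split; lra.
have uE : u = fun x => W2 x + (f 0 + x * (f 1 - f 0)).
  apply/funext => x; apply/eqP; rewrite -subr_eq0 -normr_le0; apply/ler_addgt0Pr => e e0.
  rewrite add0r; have := approx x e e0.
  by congr (`|_| <= _); rewrite {1}/f; ring.
exists (fun x => W1 x + (f 1 - f 0)).
  by move=> x; rewrite [X in is_derive _ _ X]uE; derive; ring.
by move=> x; derive; ring.
Qed.

(** The difference d from the claimed solution has zero initial data, and d^2 + d'^2 is
    conserved. *)
Lemma harmonic_oscillator (y y1 : R -> R) :
  (forall x, is_derive x 1 y (y1 x)) -> (forall x, is_derive x 1 y1 (- y x)) ->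
  forall x, y x = y 0 * cos x + y1 0 * sin x.
Proof.
move=> dy dy1 x.
pose d x := y x - (y 0 * cos x + y1 0 * sin x).
pose d1 x := y1 x - (- y 0 * sin x + y1 0 * cos x).
have dd (t : R) : is_derive t 1 d (d1 t) by rewrite /d /d1; derive; ring.
have dd1 (t : R) : is_derive t 1 d1 (- d t) by rewrite /d /d1; derive; ring.
have E (t : R) : is_derive t 1 (fun x => d x ^+ 2 + d1 x ^+ 2) 0.
  by derive => /=; ring.
have d00 : d 0 = 0 by rewrite /d cos0 sin0; ring.
have d10 : d1 0 = 0 by rewrite /d1 cos0 sin0; ring.
have h : d x ^+ 2 + d1 x ^+ 2 = 0.
  by rewrite (is_derive_eq0_cst E x 0) d00 d10 expr0n addr0.
have dx0 : d x == 0.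
  by rewrite -sqrf_eq0; apply/eqP/le_anti; rewrite sqr_ge0 andbT -h lerDl sqr_ge0.
by apply/eqP; rewrite -subr_eq0.
Qed.

Lemma polar_form (a b : R) : exists alpha rho, [/\ 0 <= alpha < 2 * pi, 0 <= rho &
  a = rho * cos alpha /\ b = rho * sin alpha].
Proof.
have pi0 := pi_gt0 R.
pose rho := Num.sqrt (a ^+ 2 + b ^+ 2).
have r2 : rho ^+ 2 = a ^+ 2 + b ^+ 2 by rewrite sqr_sqrtr// addr_ge0 ?sqr_ge0.
have [rho0|rhon0] := eqVneq rho 0.
  move: r2; rewrite rho0 expr0n/= => /esym/eqP.
  rewrite paddr_eq0 ?sqr_ge0// !sqrf_eq0 => /andP[/eqP-> /eqP->].
  by exists 0, 0; rewrite lexx mulr_gt0// !mul0r.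
have rho_gt0 : 0 < rho by rewrite lt_def rhon0 sqrtr_ge0.
pose t := a / rho.
have aE : a = rho * t by rewrite mulrC divfK.
have b2 : b ^+ 2 = rho ^+ 2 * (1 - t ^+ 2) by rewrite mulrBr mulr1 -exprMn -aE r2; ring.
have t2 : 0 <= 1 - t ^+ 2.
  by have := sqr_ge0 b; rewrite b2 pmulr_rge0// exprn_gt0.
have t1 : -1 <= t <= 1 by apply/andP; split; nra.
have bE : `|b| = rho * sin (acos t).
  apply/eqP; rewrite sin_acos// -(@eqrXn2 _ 2) ?mulr_ge0 ?sqrtr_ge0 ?(ltW rho_gt0)//.
  by rewrite exprMn [X in _ == _ * X]sqr_sqrtr// -b2 -normrX ger0_norm ?sqr_ge0.
have [a0 api] := (acos_ge0 t1, acos_lepi t1).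
have [b0|b0] := leP 0 b.
  exists (acos t), rho; split; [by rewrite a0/=; lra|exact: ltW|].
  by rewrite acosK// -bE ger0_norm.
(* Needed for 2 pi - acos t to lie strictly below 2 pi; acos t = 0 would force b = 0. *)
have at0 : 0 < acos t.
  rewrite lt_def a0 andbT; apply/eqP => h; move: bE.
  by rewrite h sin0 mulr0 => /eqP; rewrite normr_eq0 lt_eqF.
exists (2 * pi - acos t), rho; split; [|exact: ltW|].
  by apply/andP; split; lra.
have -> : cos (2 * pi - acos t) = cos (acos t).
  by rewrite addrC cosD2piE cosN.
have -> : sin (2 * pi - acos t) = - sin (acos t).
  by rewrite addrC sinD2piE sinN.
by rewrite acosK// mulrN -bE ltr0_norm// opprK.
Qed.

(* Along u'' = k^2 u^-3 - u/4 the energy u'^2 + u^2/4 + k^2 u^-2 is conserved, and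
   then (u^2)'' + u^2 is twice that constant. *)
Lemma ermakov_sqr (u v : R -> R) (k : R) : (forall x, u x != 0) ->
  (forall x, is_derive x 1 u (v x)) ->
  (forall x, is_derive x 1 v (k ^+ 2 * u x ^- 3 - 1 / 4 * u x)) ->
  exists p a b, forall x, u x ^+ 2 = p + a * cos x + b * sin x.
Proof.
move=> un0 du dv.
pose E x := v x ^+ 2 + 1 / 4 * u x ^+ 2 + k ^+ 2 * (u x ^+ 2)^-1.
have dE x : is_derive x 1 E 0.
  rewrite /E; derive => /=; first by rewrite expf_neq0.
  by field; exact: un0.
have EE x : E x = E 0 by exact: is_derive_eq0_cst dE x 0.
pose y x := u x ^+ 2 - 2 * E 0.
have dy x : is_derive x 1 y (2 * u x * v x) by rewrite /y; derive => /=; ring.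
have dy1 x : is_derive x 1 (fun x => 2 * u x * v x) (- y x).
  derive; rewrite /y -(EE x) /E; field; exact: un0.
exists (2 * E 0), (y 0), (2 * u 0 * v 0) => x.
by have := harmonic_oscillator dy dy1 x; rewrite {1}/y; lra.
Qed.

Lemma extremal_form (u : R -> R) (p a b : R) : (forall x, 0 < u x) ->
  (forall x, u x ^+ 2 = p + a * cos x + b * sin x) ->
  exists lambda c alpha : R,
     [/\ 0 < lambda, 0 < c, 0 <= alpha < 2 * pi &
         forall x : R,
           u x = c * Num.sqrt (lambda ^+ 2 * cos ((x - alpha) / 2) ^+ 2
                               + lambda ^- 2 * sin ((x - alpha) / 2) ^+ 2)].
Proof.
move=> u0 uE; have [alpha [rho [alpha02 rho0 [aE bE]]]] := polar_form a b.
have uE' x : u x ^+ 2 = p + rho * cos (x - alpha).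
  by rewrite uE aE bE cosB; ring.
(* The value of u^2 at alpha + pi, where the cosine is -1. *)
have prho : 0 < p - rho.
  have := uE' (alpha + pi); rewrite addrAC subrr add0r cospi.
  by have := exprn_gt0 2 (u0 (alpha + pi)); lra.
have prho' : 0 < p + rho by lra.
pose P := Num.sqrt (p + rho); pose M := Num.sqrt (p - rho).
have P0 : 0 < P by rewrite sqrtr_gt0.
have M0 : 0 < M by rewrite sqrtr_gt0.
have P2 : P ^+ 2 = p + rho by rewrite sqr_sqrtr// ltW.
have M2 : M ^+ 2 = p - rho by rewrite sqr_sqrtr// ltW.
have PM : 0 < P / M by rewrite divr_gt0.
(* In half angles u^2 = P^2 C^2 + M^2 S^2; these solve c^2 l^2 = P^2 and c^2 l^-2 = M^2. *)
pose l := Num.sqrt (P / M); pose c := Num.sqrt (P * M).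
have l2 : l ^+ 2 = P / M by rewrite sqr_sqrtr// ltW.
have c2 : c ^+ 2 = P * M by rewrite sqr_sqrtr// mulr_ge0// ltW.
have c0 : 0 < c by rewrite sqrtr_gt0 mulr_gt0.
exists l, c, alpha; split=> //; first by rewrite sqrtr_gt0.
move=> x; rewrite l2; set C := cos _; set S := sin _.
have CS : C ^+ 2 + S ^+ 2 = 1 by exact: cos2Dsin2.
have xE : cos (x - alpha) = C ^+ 2 - S ^+ 2.
  have -> : x - alpha = (x - alpha) / 2 + (x - alpha) / 2 by field.
  by rewrite cosD -/C -/S; ring.
have -> : u x = Num.sqrt (u x ^+ 2) by rewrite sqrtr_sqr gtr0_norm.
rewrite -[c in RHS]gtr0_norm// -sqrtr_sqr -sqrtrM ?sqr_ge0//; congr Num.sqrt.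
have -> : u x ^+ 2 = (p + rho) * C ^+ 2 + (p - rho) * S ^+ 2.
  by rewrite uE' xE -[p in LHS]mulr1 -CS; ring.
by rewrite c2 -P2 -M2; field; rewrite !gt_eqF.
Qed.

End extremals.

(** * Uniqueness of the weak derivative *)

Section weak_derivative_uniqueness.
Set Implicit Arguments.
Unset Strict Implicit.
Context {R : realType}.
Implicit Types (x y z e t : R).
Local Notation mu := (@lebesgue_measure R).
Local Notation circle := (`[0%R, (2 * pi)%R]%classic : set R).

Lemma circle_integral_dominated0 (v h : R -> R) (h_ : nat -> R -> R) :
  circle_integrable v -> (forall n, continuous (h_ n)) ->
  (forall n x, `|h_ n x| <= 1) -> measurable_fun circle h ->
  (forall x, x \in `[0, 2 * pi] -> h_ ^~ x @ \oo --> h x) ->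
  (forall n, circle_integral (fun x => v x * h_ n x) = 0) ->
  circle_integral (fun x => v x * h x) = 0.
Proof.
move=> vi ch h1 mh hh I0.
have vhi n : circle_integrable (fun x => v x * h_ n x) by exact: circle_integrableM.
have mv := circle_integrable_measurable vi.
have mh_ n : measurable_fun circle (h_ n).
  exact: circle_integrable_measurable (circle_integrable_continuous (ch n)).
have mvh : measurable_fun circle (fun x => v x * h x) by exact: measurable_funM.
have mvhn n : measurable_fun circle (fun x => v x * h_ n x) by exact: measurable_funM.
have cvgvh : {ae mu, forall x, circle x ->
    (v x * h_ n x)%:E @[n --> \oo] --> (v x * h x)%:E}.
  apply: aeW => x xC; apply: cvg_EFin; first exact: nearW.
  by apply: cvgMr; exact: hh.
have domvh : {ae mu, forall x n, circle x -> (`|(v x * h_ n x)%:E| <= `|v x|%:E)%E}.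
  by apply: aeW => x n _ /=; rewrite lee_fin normrM ler_piMr.
have [_ _] := @dominated_convergence _ _ R mu circle (measurable_itv _)
  (fun n x => (v x * h_ n x)%:E) (fun x => (v x * h x)%:E) (fun x => `|v x|%:E)
  (fun n => proj2 (measurable_EFinP circle _) (mvhn n))
  (proj2 (measurable_EFinP circle _) mvh) cvgvh (integrable_norm vi) domvh.
have -> : [sequence (\int[mu]_(x in circle) (v x * h_ n x)%:E)%E]_n = (fun=> 0%E).
  apply/funext => n /=; rewrite -[LHS]fineK; last exact: integrable_fin_num (vhi n).
  by congr EFin; exact: I0.
move=> vh0; suff : (\int[mu]_(x in circle) (v x * h x)%:E = 0)%E by move=> E; rewrite /circle_integral /Rintegral E.
by apply/esym; exact: (cvg_unique _ (cvg_cst _) vh0).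
Qed.

(* The sign of cos(t - x/2) - cos(x/2) = 2 sin(t/2) sin((x-t)/2) tells ]0, x[ from
   ]x, 2pi[, so truncations of its multiples are periodic cut-offs of ]0, x[. *)
Definition arc_cutoff x n t : R :=
  Num.min 1 (n%:R * Num.max 0 (cos (t - x / 2) - cos (x / 2))).

Lemma arc_cutoff_continuous x n : continuous (arc_cutoff x n).
Proof.
have c1 : continuous (fun t => cos (t - x / 2) - cos (x / 2)) by cont.
have c2 : continuous (fun t => Num.max 0 (cos (t - x / 2) - cos (x / 2))).
  by move=> t; apply: (@continuous_max R R (cst 0) _ t (@cst_continuous R R 0 t) (c1 t)).
have c3 : continuous (fun t => n%:R * Num.max 0 (cos (t - x / 2) - cos (x / 2))).
  by apply: (continuous_funM (f := fun=> n%:R)) => //; exact: continuous_fun_cst.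
by move=> t; apply: (@continuous_min R R (cst 1) _ t (@cst_continuous R R 1 t) (c3 t)).
Qed.

Lemma arc_cutoff_circle_fun x n : circle_fun (arc_cutoff x n).
Proof. by move=> t; rewrite /arc_cutoff addrAC cosD2piE. Qed.

Lemma arc_cutoff_le1 x n t : `|arc_cutoff x n t| <= 1.
Proof.
have h : 0 <= n%:R * Num.max 0 (cos (t - x / 2) - cos (x / 2)) :> R.
  by rewrite mulr_ge0// le_max lexx.
by rewrite ger0_norm /arc_cutoff ?ge_min ?lexx// le_min ler01.
Qed.

(** Inside the arc n times the positive gap eventually exceeds 1 and the minimum is 1; elsewhere,
    endpoints included, the cut-off is 0 for every n. *)
Lemma arc_cutoff_cvg x t : 0 < x < 2 * pi -> t \in `[0, 2 * pi] ->
  arc_cutoff x n t @[n --> \oo] --> (\1_(`]0%R, x[%classic) t : R).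
Proof.
move=> /andP[x0 x2]; rewrite in_itv/= => /andP[t0 t2].
have E : cos (t - x / 2) - cos (x / 2) = 2 * (sin (t / 2) * sin ((x - t) / 2)).
  have -> : t - x / 2 = t / 2 - (x - t) / 2 by field.
  have -> : x / 2 = t / 2 + (x - t) / 2 by field.
  by rewrite cosB cosD; ring.
have st0 : 0 <= sin (t / 2) by rewrite sin_ge0_pi//; lra.
rewrite /arc_cutoff E indicE.
have [tx|tx] := boolP (t \in (`]0%R, x[%classic : set R)).
  move: tx; rewrite inE/= in_itv/= => /andP[t00 tx].
  set s := 2 * _; have s0 : 0 < s by rewrite !mulr_gt0// sin_gt0_pi//; lra.
  apply: cvg_near_cst; near=> n.
  rewrite (max_idPr (ltW s0)); apply: min_idPl.
  rewrite -ler_pdivrMr//.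
  near: n; exact: nbhs_infty_ger.
have s0 : 2 * (sin (t / 2) * sin ((x - t) / 2)) <= 0.
  rewrite pmulr_rle0//; have [->|tn0] := eqVneq t 0; first by rewrite mul0r sin0 mul0r.
  rewrite mulr_ge0_le0// -oppr_ge0 -sinN sin_ge0_pi//.
  move: tx; rewrite notin_setE/= in_itv/= lt_def tn0 t0/= => /negP; rewrite -leNgt => xt.
  lra.
apply: cvg_near_cst; near=> n.
by rewrite (max_idPl s0) mulr0; apply: min_idPr.
Unshelve. all: by end_near. Qed.

(** Mollifications of h are trigonometric polynomials, hence test functions, and they approach h
    uniformly. *)
Lemma orthogonal_smooth_continuous (v h : R -> R) : circle_integrable v ->
  (forall phi, smooth_circle phi -> circle_integral (fun x => v x * phi x) = 0) ->
  continuous h -> circle_fun h -> circle_integral (fun x => v x * h x) = 0.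
Proof.
move=> vi v0 ch ph; apply/eqP; rewrite -normr_le0; apply/ler_addgt0Pr => e e0.
rewrite add0r; set V := circle_integral (fun x => `|v x|).
have V0 : 0 <= V by apply: circle_integral_ge0.
have d0 : 0 < e / (V + 1) by rewrite divr_gt0//; lra.
have [N HN] := mollify_cvg_everywhere ch ph d0.
have hi := circle_integrable_continuous ch.
have tm := mollify_trigpoly N hi.
have cm := trigpoly_continuous tm.
have cd : continuous (fun x => h x - mollify N h x) by cont.
have -> : circle_integral (fun x => v x * h x) =
    circle_integral (fun x => v x * (h x - mollify N h x)).
  have E : (fun x => v x * (h x - mollify N h x)) =
      (fun x => v x * h x - v x * mollify N h x).
    by apply/funext => x; rewrite mulrBr.
  rewrite E circle_integralB; [|exact: circle_integrableM..].
  by rewrite (v0 _ (trigpoly_smooth tm)) subr0.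
have vhi : circle_integrable (fun x => v x * (h x - mollify N h x)) by exact: circle_integrableM.
have nvi : circle_integrable (fun x => `|v x|) by exact: integrable_norm vi.
apply: (le_trans (@le_normr_Rintegral _ _ _ mu circle _ (measurable_itv _) vhi)).
have : circle_integral (fun x => `|v x * (h x - mollify N h x)|) <=
       circle_integral (fun x => e / (V + 1) * `|v x|).
  apply: le_circle_integral; [exact: integrable_norm vhi|exact: circle_integrableZ|].
  by move=> x _; rewrite normrM mulrC ler_wpM2r// distrC HN.
move=> /le_trans; apply; rewrite circle_integralZ// -/V.
by rewrite mulrAC ler_pdivrMr; nra.
Qed.

Lemma orthogonal_smooth_arc (v : R -> R) x : circle_integrable v ->
  (forall phi, smooth_circle phi -> circle_integral (fun x => v x * phi x) = 0) ->
  0 < x < 2 * pi -> \int[mu]_(t in `[0%R, x]%classic) v t = 0.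
Proof.
move=> vi v0 x02; have /andP[x0 x2] := x02.
have arc0 : circle_integral (fun t => v t * \1_(`]0%R, x[%classic) t) = 0.
  apply: (@circle_integral_dominated0 v _ (arc_cutoff x) vi).
  - exact: arc_cutoff_continuous.
  - exact: arc_cutoff_le1.
  - exact: measurable_indic.
  - by move=> t tC; exact: arc_cutoff_cvg.
  - move=> n; apply: orthogonal_smooth_continuous => //.
      exact: arc_cutoff_continuous.
    exact: arc_cutoff_circle_fun.
have sub : `]0%R, x[%classic `<=` circle.
  by apply: subset_itv; rewrite bnd_simp// ltW.
have vix b1 b2 : mu.-integrable [set` Interval (BSide b1 0) (BSide b2 x)] (EFin \o v).
  apply: (@integrableS _ _ _ mu circle) => //.
  by apply: subset_itv; rewrite ?bnd_simp//; case: b2; rewrite ?bnd_simp// ltW.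
rewrite -Rintegral_itv_obnd_cbnd; last exact: vix.
rewrite -Rintegral_itv_bndo_bndc; last exact: vix.
transitivity (\int[mu]_(t in circle `&` `]0%R, x[%classic) v t).
  by rewrite (setIidr sub).
rewrite Rintegral_mkcondr -[RHS]arc0; congr (Rintegral mu circle _).
by apply/funext => t; rewrite patchE indicE; case: ifP; rewrite ?mulr1 ?mulr0.
Qed.

(** Extended by 0 to the line, v has an identically zero indefinite integral, and Lebesgue
    differentiation recovers v = 0 almost everywhere. *)
Lemma orthogonal_smooth_ae0 (v : R -> R) : circle_integrable v ->
  (forall phi, smooth_circle phi -> circle_integral (fun x => v x * phi x) = 0) ->
  {ae mu, forall x, circle x -> v x = 0}.
Proof.
move=> vi v0; pose f := v \_ circle.
have fi : mu.-integrable setT (EFin \o f).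
  rewrite -restrict_EFin; apply/integrable_restrict => //.
  by rewrite setTI.
have fiy y : mu.-integrable `]-oo, y] (EFin \o f).
  exact: (@integrableS _ _ _ mu setT).
have locf : locally_integrable setT f by exact: open_integrable_locally openT fi.
have F0 y : \int[mu]_(t in `]-oo, y]%classic) f t = 0.
  rewrite /f -Rintegral_mkcondr.
  have [y0|y0] := ltP y 0.
    rewrite (_ : _ `&` _ = set0) ?Rintegral_set0// -subset0 => t [] /=.
    by rewrite !in_itv/= => ty /andP[t0 _]; lra.
  (* Beyond 2 pi the integral runs over the whole circle and is tested against the constant 1. *)
  have [y2|y2] := ltP y (2 * pi); last first.
    rewrite setIidr.
      have := v0 _ (trigpoly_smooth (trigpoly_cst 1)).
      by under eq_fun do rewrite mulr1.
    move=> t /=; rewrite !in_itv/= => /andP[_ t2]; lra.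
  rewrite (_ : _ `&` _ = `[0, y]%classic); last first.
    apply/seteqP; split=> t /=; rewrite !in_itv/=.
      by move=> [ty /andP[-> _]].
    by move=> /andP[-> ty]; split=> //=; lra.
  have [->|yn0] := eqVneq y 0; first by rewrite set_itv1 Rintegral_set1.
  by apply: orthogonal_smooth_arc => //; rewrite lt_def yn0 y0.
have := FTC1Ny fiy locf.
apply: filterS; first exact: (ae_filter_ringOfSetsType mu).
move=> x [_ +] xC.
rewrite (_ : (fun _ => _) = cst 0); last by apply/funext => y; exact: F0.
by rewrite derive1_cst /f patchE mem_set// => /esym.
Qed.

(** Both du and v are weak derivatives of u, so their difference is orthogonal to all test functions
    and vanishes almost everywhere. *)
Lemma weak_derivative_unique_integral (u du v : R -> R) : L2_circle du ->
  weak_derivative u du -> continuous u -> circle_fun u -> continuous v ->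
  (forall x, is_derive x 1 u (v x)) ->
  circle_integral (fun x => du x ^+ 2 - 1 / 4 * u x ^+ 2) =
  circle_integral (fun x => v x ^+ 2 - 1 / 4 * u x ^+ 2).
Proof.
move=> L2du wu cu pu cv vE; have dui := L2_circle_integrable L2du.
have vi := circle_integrable_continuous cv.
have wv := C1_weak_derivative vE cv pu.
have du2i : circle_integrable (fun x => du x ^+ 2) by case: L2du.
have q2i : circle_integrable (fun x => 1 / 4 * u x ^+ 2).
  by apply: circle_integrable_continuous; cont.
have v2i : circle_integrable (fun x => v x ^+ 2).
  by apply: circle_integrable_continuous; cont.
have ae0 : {ae mu, forall x, circle x -> du x - v x = 0}.
  apply: orthogonal_smooth_ae0; first exact: circle_integrableB.
  move=> phi sphi; have [_ cphi _ _] := smooth_circle_derive sphi.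
  have E : (fun x => (du x - v x) * phi x) = (fun x => du x * phi x - v x * phi x).
    by apply/funext => x; rewrite mulrBl.
  rewrite E circle_integralB; [|exact: circle_integrableM..].
  by have := wu phi sphi; rewrite (wv phi sphi) => /oppr_inj ->; rewrite subrr.
rewrite /circle_integral /Rintegral; congr fine; apply: ae_eq_integral => //.
- exact: (measurable_int mu (circle_integrableB du2i q2i)).
- exact: (measurable_int mu (circle_integrableB v2i q2i)).
- move: ae0; apply: filterS; first exact: (ae_filter_ringOfSetsType mu).
  move=> x h xC; congr EFin; rewrite /=; have /eqP := h xC; by rewrite subr_eq0 => /eqP ->.
Qed.

End weak_derivative_uniqueness.

(** * Evaluation of the product on the explicit family *)

Section extremal_values.
Set Implicit Arguments.
Unset Strict Implicit.
Context {R : realType}.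
Implicit Types (x y z e t : R).
Local Opaque circle_integral.

Lemma extremal_value (u : R -> R) (lambda c alpha : R) : 0 < lambda -> 0 < c ->
  circle_fun u -> (forall x, 0 < u x) ->
  (forall x, u x = c * Num.sqrt (lambda ^+ 2 * cos ((x - alpha) / 2) ^+ 2
                               + lambda ^- 2 * sin ((x - alpha) / 2) ^+ 2)) ->
  exists2 v, (forall x, is_derive x 1 u (v x)) /\ continuous v &
    circle_integral (fun x => v x ^+ 2 - 1 / 4 * u x ^+ 2) *
      circle_integral (fun x => u x ^- 2) = - pi ^+ 2.
Proof.
move=> l0 c0 pu u0 uE.
pose a := lambda ^+ 2; have a0 : 0 < a by rewrite exprn_gt0.
have an0 : a != 0 by rewrite gt_eqF.
have cn0 : c != 0 by rewrite gt_eqF.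
pose C x := cos ((x - alpha) / 2); pose S x := sin ((x - alpha) / 2).
have CS x : C x ^+ 2 + S x ^+ 2 = 1 by exact: cos2Dsin2.
have dC x : is_derive x 1 C (- S x / 2) by rewrite /C /S; derive; field.
have dS x : is_derive x 1 S (C x / 2) by rewrite /C /S; derive; field.
have cC := is_derive_continuous dC; have cS := is_derive_continuous dS.
pose W x := a * C x ^+ 2 + a^-1 * S x ^+ 2.
have aV0 : 0 < a^-1 by rewrite invr_gt0.
have C2S2 x : 0 < C x ^+ 2 \/ 0 < S x ^+ 2.
  have [h|h] := ltP 0 (C x ^+ 2); [by left|right].
  by have := CS x; lra.
have W0 x : 0 < W x.
  have [C2 S2] := (sqr_ge0 (C x), sqr_ge0 (S x)).
  have h1 := mulr_ge0 (ltW a0) C2; have h2 := mulr_ge0 (ltW aV0) S2.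
  rewrite /W; have [h|h] := C2S2 x.
    by have := mulr_gt0 a0 h; lra.
  by have := mulr_gt0 aV0 h; lra.
have Wn0 x : W x != 0 by rewrite gt_eqF.
have un0 x : u x != 0 by rewrite gt_eqF.
pose dW x := (a^-1 - a) * S x * C x.
have dWE x : is_derive x 1 W (dW x) by rewrite /W /dW; derive => /=; field.
have cdW : continuous dW by rewrite /dW; cont.
have uW x : u x = c * Num.sqrt (W x) by rewrite uE.
have u2 x : u x ^+ 2 = c ^+ 2 * W x by rewrite uW exprMn sqr_sqrtr// ltW.
pose v x := c ^+ 2 / 2 * dW x / u x.
have vE x : is_derive x 1 u (v x).
  have -> : u = fun x => c * Num.sqrt (W x) by apply/funext.
  derive; first exact: W0.
  rewrite /v uW; have s0 : Num.sqrt (W x) != 0 by rewrite gt_eqF// sqrtr_gt0.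
  by field; rewrite cn0 s0.
have cu := is_derive_continuous vE.
have cv : continuous v by rewrite /v; cont.
exists v => //.
have ci (f : R -> R) : continuous f -> circle_integrable f.
  exact: circle_integrable_continuous.
have u2n0 x : u x ^+ 2 != 0 by rewrite expf_neq0.
have cuV : continuous (fun x => u x ^- 2) by cont.
set L := circle_integral (fun x => u x ^- 2).
have LE : L = 2 / c ^+ 2 * pi.
  pose D x := C x ^+ 2 + a^-1 * S x ^+ 2.
  have Dn0 x : D x != 0.
    have [C2 S2] := (sqr_ge0 (C x), sqr_ge0 (S x)).
    have h2 := mulr_ge0 (ltW aV0) S2.
    rewrite gt_eqF// /D; have [h|h] := C2S2 x; first by lra.
    by have := mulr_gt0 aV0 h; lra.
  pose N x := (a^-1 - 1) * (S x * C x).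
  (* The usual antiderivative atan(a^-1 tan s), s = (x - alpha)/2, jumps at the poles of the
     tangent. By the subtraction formula atan(a^-1 tan s) - s becomes atan(N/D), smooth because D >
     0; F is thus the continuous lift, with F' = 1/(2 W). *)
  pose F x := (x - alpha) / 2 + atan (N x / D x).
  have dF x : is_derive x 1 (fun x => 2 / c ^+ 2 * F x) (u x ^- 2).
    rewrite /F /N /D; derive => /=; first exact: Dn0.
    rewrite u2.
    have ND : 1 + (N x / D x) ^+ 2 = a^-1 * W x / D x ^+ 2.
      rewrite -[1](divff (expf_neq0 2 (Dn0 x))) expr_div_n -mulrDl; congr (_ / _).
      rewrite /D /N /W; transitivity ((C x ^+ 2 + a^-2 * S x ^+ 2) * (C x ^+ 2 + S x ^+ 2)).
        by field.
      by rewrite CS; field.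
    rewrite -/(D x) -/(N x) ND.
    have := CS x; have := Dn0 x; have := Wn0 x; rewrite /D /N /W.
    move: (C x) (S x) => p q Wn Dn pq.
    have pq2 : p ^+ 2 = 1 - q ^+ 2 by lra.
    pose Y := a * p ^+ 2 + a^-1 * q ^+ 2; pose Z := p ^+ 2 + a^-1 * q ^+ 2.
    have key : Y * a^-1 - 2 * (a^-1 - 1) ^+ 2 * (p ^+ 2 * q ^+ 2) +
        Z * (a^-1 - 1) * (p ^+ 2 - q ^+ 2) = a^-1.
      by rewrite /Y /Z pq2; field.
    rewrite -/Y -/Z in Wn Dn *.
    transitivity (c ^- 2 * ((Y * a^-1 - 2 * (a^-1 - 1) ^+ 2 * (p ^+ 2 * q ^+ 2) +
        Z * (a^-1 - 1) * (p ^+ 2 - q ^+ 2)) / (a^-1 * Y))); last first.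
      by rewrite key; field; rewrite Wn cn0 an0.
    move: Wn Dn key; move: (atan _) => At.
    by clearbody Y Z => Wn Dn _; field; rewrite ?Wn ?Dn ?cn0 ?an0.
  rewrite /L (circle_integral_FTC cuV dF) -[2 * pi]add0r /F /N /D.
  (* Over a period C and S change sign, so N/D is unchanged and F grows by exactly pi. *)
  have shift : (0 + 2 * pi - alpha) / 2 = (0 - alpha) / 2 + pi by field.
  rewrite /S /C shift sinDpi cosDpi !mulrNN !sqrrN; ring.
have I0 : circle_integral (fun x => cos (x - alpha)) = 0.
  have dsin x : is_derive x 1 (fun x => sin (x - alpha)) (cos (x - alpha)).
    by derive; ring.
  rewrite (@circle_integral_FTC R _ _ _ dsin).
    have -> : 2 * pi - alpha = (0 - alpha) + 2 * pi by ring.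
    by rewrite sinD2piE subrr.
  by cont; apply: continuous_fun_id.
(* Pointwise v^2 - u^2/4 = - m cos(x - alpha) - (c^4/4) u^-2. The cosine integrates to 0, so the
   product is - (c^4/4) L^2 with L = 2 pi / c^2. *)
pose m := c ^+ 2 / 4 * (a - a^-1).
have -> : circle_integral (fun x => v x ^+ 2 - 1 / 4 * u x ^+ 2) =
          - m * circle_integral (fun x => cos (x - alpha)) - c ^+ 4 / 4 * L.
  have cosi : circle_integrable (fun x => cos (x - alpha)) by apply: ci; cont.
  rewrite -!circle_integralZ//; last exact: ci.
  rewrite -circle_integralB; [|exact/circle_integrableZ|exact/circle_integrableZ/ci].
  congr circle_integral; apply/funext => x.
  have -> : cos (x - alpha) = C x ^+ 2 - S x ^+ 2.
    have -> : x - alpha = (x - alpha) / 2 + (x - alpha) / 2 by field.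
    by rewrite cosD -/(C x) -/(S x); ring.
  have -> : v x ^+ 2 = (c ^+ 2 / 2 * dW x) ^+ 2 / (u x ^+ 2) by rewrite expr_div_n.
  rewrite u2 /dW; have := Wn0 x; have := CS x; rewrite /W.
  move: (C x) (S x) => p q pq Wn.
  have pq2 : p ^+ 2 = 1 - q ^+ 2 by lra.
  pose Y := a * p ^+ 2 + a^-1 * q ^+ 2; rewrite -/Y in Wn *.
  have key : ((a^-1 - a) * q * p) ^+ 2 = Y ^+ 2 - 1 - Y * (a - a^-1) * (p ^+ 2 - q ^+ 2).
    rewrite !exprMn /Y pq2; field; exact: an0.
  rewrite exprMn key /m; field.
  by rewrite Wn cn0 an0.
rewrite I0 mulr0 sub0r LE; field; exact: cn0.
Qed.

End extremal_values.

(* u is the continuous representative of an element of H^1(S^1) and du is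
   (any representative of) its weak derivative u_theta. *)
Theorem theorem2 (R : realType) (u du : R -> R)
    (hu : H1_circle u) (ucont : continuous u) (upos : forall x, 0 < u x)
    (hdu : L2_circle du) (udu : weak_derivative u du) :
  circle_integral (fun x => du x ^+ 2 - 1 / 4 * u x ^+ 2) *
    circle_integral (fun x => u x ^- 2) >= - pi ^+ 2
  /\
  (circle_integral (fun x => du x ^+ 2 - 1 / 4 * u x ^+ 2) *
     circle_integral (fun x => u x ^- 2) = - pi ^+ 2
   <->
   exists lambda c alpha : R,
     [/\ 0 < lambda, 0 < c, 0 <= alpha < 2 * pi &
         forall x : R,
           u x = c * Num.sqrt (lambda ^+ 2 * cos ((x - alpha) / 2) ^+ 2
                               + lambda ^- 2 * sin ((x - alpha) / 2) ^+ 2)]).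
Proof.
have [[pu _ _] _] := hu.
split; first exact: circle_inequality.
split=> [extremal|[lambda [c [alpha [l0 c0 _ uE]]]]].
  have dui := L2_circle_integrable hdu.
  have [k wdu] := extremal_weak_second_derivative ucont pu upos hdu udu extremal.
  have un0 x : u x != 0 by rewrite gt_eqF.
  have u3n0 x : u x ^+ 3 != 0 by rewrite expf_neq0.
  have cw : continuous (fun x => k ^+ 2 * u x ^- 3 - 1 / 4 * u x) by cont.
  have pw : circle_fun (fun x => k ^+ 2 * u x ^- 3 - 1 / 4 * u x).
    by move=> x; rewrite pu.
  have [v vE v'E] := weak_second_derivative_C2 ucont pu dui cw pw udu wdu.
  have [p [a [b u2E]]] := ermakov_sqr un0 vE v'E.
  exact: extremal_form upos u2E.
have [v [vE cv] value] := extremal_value l0 c0 pu upos uE.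
by rewrite (weak_derivative_unique_integral hdu udu ucont pu cv vE).
Qed.
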